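(* Let $E$ be a polarized complex variation of Hodge structure of weight $n$ on the punctured disk $\Delta^{*}=\{t\in\mathbb{C}: 0<|t|<1\}$, and let $T\in\mathrm{GL}(V)$ be the monodromy operator on the space $V$ of multi-valued flat sections. If $\lambda\in\mathbb{C}$ is an eigenvalue of $T$, then $|\lambda|=1$.
   Context: A polarized (complex) variation of Hodge structure of weight $n$ on a complex manifold $X$ is a smooth complex vector bundle $E$ (of finite rank) with a decomposition $E=\bigoplus_{p+q=n}E^{p,q}$ into smooth subbundles, a flat connection $d$ mapping $A^0(X,E^{p,q})$ into $A^{1,0}(X,E^{p,q})\oplus A^{1,0}(X,E^{p-1,q+1})\oplus A^{0,1}(X,E^{p,q})\oplus A^{0,1}(X,E^{p+1,q-1})$, and a $d$-flat hermitian pairing $Q$ on $E$ for which the $E^{p,q}$ are mutually orthogonal and such that $h(v,w)=\sum_{p+q=n}(-1)^qQ(v^{p,q},w^{p,q})$ is a smooth hermitian (positive definite) metric on $E$, called the Hodge metric. No integral, rational or real structure is assumed. Let $\mathbb{H}=\{z\in\mathbb{C}:\operatorname{Re}z<0\}$, with universal covering map $\exp:\mathbb{H}\to\Delta^{*}$. $V$ is the finite-dimensional complex vector space of $d$-flat sections of $\exp^{*}E$ on $\mathbb{H}$ (multi-valued flat sections), and $T\in\mathrm{GL}(V)$ is defined by $(Tv)(z)=v(z-2\pi i)$. *)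

(* Defs.v *)
From HB Require Import structures.
From mathcomp Require Import all_boot all_order all_algebra sesquilinear.
From mathcomp Require Import all_classical all_reals all_analysis.
From mathcomp Require Import complex.

Set Implicit Arguments.
Unset Strict Implicit.
Unset Printing Implicit Defensive.

Import Order.TTheory GRing.Theory Num.Theory.
Import numFieldNormedType.Exports.

Local Open Scope classical_set_scope.
Local Open Scope ring_scope.
Local Open Scope complex_scope.

Local Notation Re := (@complex.Re _).
Local Notation Im := (@complex.Im _).

(* Smooth means smooth in the real sense. The library does not put a real
   normed structure on R[i], so C is identified with the normed space R * R
   through (x, y) |-> x + i y. *)
Section SmoothFunctions.
Variable R : realType.
Local Notation C := R[i].
Implicit Types (U : set C) (f : C -> C).

Definition plane (A : set C) : set (R * R) := [set p | A (p.1 +i* p.2)].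

Definition openC U : Prop := open (plane U).

Fixpoint Ck (k : nat) (U : set (R * R)) (g : R * R -> R) : Prop :=
  (forall p, U p -> continuous_at p g) /\
  if k is k'.+1 then
    [/\ forall p, U p -> derivable g p (1, 0) /\ derivable g p (0, 1),
        Ck k' U (fun p => 'D_(1, 0) g p)
      & Ck k' U (fun p => 'D_(0, 1) g p)]
  else True.

Definition re_fun f : R * R -> R := fun p => Re (f (p.1 +i* p.2)).
Definition im_fun f : R * R -> R := fun p => Im (f (p.1 +i* p.2)).

(* Used for U open only, so that 'D on U depends only on f on U. *)
Definition smooth_on U f : Prop :=
  forall k, Ck k (plane U) (re_fun f) /\ Ck k (plane U) (im_fun f).

Definition pderiv (e : R * R) f : C -> C := fun z =>
  ('D_e (re_fun f) (Re z, Im z)) +i* ('D_e (im_fun f) (Re z, Im z)).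

(* The Wirtinger operators: df = (dz f) dz + (dzbar f) dzbar. *)
Definition dz f : C -> C := fun z =>
  (pderiv (1, 0) f z - 'i%C * pderiv (0, 1) f z) / 2%:R.
Definition dzbar f : C -> C := fun z =>
  (pderiv (1, 0) f z + 'i%C * pderiv (0, 1) f z) / 2%:R.

Definition cexp (z : C) : C :=
  (expR (Re z))%:C * (cos (Im z) +i* sin (Im z)).

Definition two_pi_i : C := 0 +i* (pi *+ 2).

Lemma cexpB2pi (z : C) : cexp (z - two_pi_i) = cexp z.
Proof.
case: z => x y; rewrite /cexp /two_pi_i /= subr0.
by rewrite -(cosD2pi (y - pi *+ 2)) -(sinD2pi (y - pi *+ 2)) subrK.
Qed.

Definition half_plane : set C := [set z | Re z < 0].
Definition punctured_disk : set C := [set t | 0 < `|t| < 1].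

End SmoothFunctions.

Arguments cexp {R}.
Arguments half_plane {R}.
Arguments punctured_disk {R}.

(* A smooth complex vector bundle of finite rank over X, given by its fibres
   and an atlas of local trivializations which are fibrewise linear and have
   smooth transition matrices. Fibres are indexed by all of C, but the fibre
   over t is meaningful only for t in X. The rank is constant, X being
   connected in the application. *)
Record bundle (R : realType) (X : set R[i]) := Bundle {
  fiber :> R[i] -> vectType R[i];
  rank : nat;
  chart : Type;
  dom : chart -> set R[i];
  triv : forall (i : chart) (t : R[i]), 'Hom(fiber t, 'cV[R[i]]_rank);
  dom_open : forall i, openC (dom i);
  dom_cover : \bigcup_i dom i = X;
  triv_bij : forall i t, dom i t -> bijective (triv i t);
  triv_smooth : forall i j k l, smooth_on (dom i `&` dom j)
    (fun t => triv j t ((triv i t)^-1%VF (delta_mx k 0)) l 0)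
}.

Section Bundles.
Variables (R : realType) (X : set R[i]).
Local Notation C := R[i].

(* Local sections over an open U of X are represented by total functions;
   their values outside U are irrelevant. *)
Definition section (E : bundle X) : Type := forall t : C, E t.

Definition frame (E : bundle X) (i : chart E) (k : 'I_(rank E)) : section E :=
  fun t => (triv i t)^-1%VF (delta_mx k 0).

Definition smooth_section (E : bundle X) (U : set C) (s : section E) : Prop :=
  forall (i : chart E) (k : 'I_(rank E)),
    smooth_on (U `&` dom i) (fun t => triv i t (s t) k 0).

Definition smooth_subbundle (E : bundle X) (F : forall t : C, {vspace E t}) :
    Prop :=
  forall t0, X t0 -> exists (U : set C) (m : nat) (e : 'I_m -> section E),
    [/\ openC U, U t0, U `<=` X, (forall k, smooth_section U (e k))
      & forall t, U t -> basis_of (F t) [tuple e k t | k < m]].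

(* A connection d on E, as an operator on local smooth sections. The 1-forms
   dt and dtbar trivialize A^{1,0} and A^{0,1}, so that
   d s = (d10 s) dt + (d01 s) dtbar for two operators d10, d01 on sections.
   Locality makes d compatible with restriction to smaller open sets. *)
Record connection (E : bundle X) := Connection {
  d10 : section E -> section E;
  d01 : section E -> section E;
  d_smooth : forall U s, openC U -> U `<=` X -> smooth_section U s ->
    smooth_section U (d10 s) /\ smooth_section U (d01 s);
  d_local : forall U s s', openC U -> U `<=` X -> smooth_section U s ->
    (forall t, U t -> s t = s' t) ->
    forall t, U t -> d10 s t = d10 s' t /\ d01 s t = d01 s' t;
  d_additive : forall U s s', openC U -> U `<=` X ->
    smooth_section U s -> smooth_section U s' ->
    forall t, U t ->
      d10 (fun x => s x + s' x) t = d10 s t + d10 s' t /\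
      d01 (fun x => s x + s' x) t = d01 s t + d01 s' t;
  d_leibniz : forall U (f : C -> C) s, openC U -> U `<=` X ->
    smooth_on U f -> smooth_section U s ->
    forall t, U t ->
      d10 (fun x => f x *: s x) t = dz f t *: s t + f t *: d10 s t /\
      d01 (fun x => f x *: s x) t = dzbar f t *: s t + f t *: d01 s t
}.

(* d o d = 0: the coefficient of dt /\ dtbar in d (d s) is
   d10 (d01 s) - d01 (d10 s). *)
Definition flat (E : bundle X) (d : connection E) : Prop :=
  forall U s, openC U -> U `<=` X -> smooth_section U s ->
    forall t, U t -> d10 d (d01 d s) t = d01 d (d10 d s) t.

Definition pairing (E : bundle X) : Type :=
  forall t : C, {hermitian_sym (E t) for @conjc R}.

Definition smooth_pairing (E : bundle X)
    (Q : forall t : C, E t -> E t -> C) : Prop :=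
  forall U s s', openC U -> U `<=` X ->
    smooth_section U s -> smooth_section U s' ->
    smooth_on U (fun t => Q t (s t) (s' t)).

(* d Q(s, s') = Q(d s, s') + Q(s, d s'), split by type; Q is conjugate-linear
   in its second argument, so the dtbar part of d s' contributes to dt. *)
Definition flat_pairing (E : bundle X) (d : connection E) (Q : pairing E) :
    Prop :=
  forall U s s', openC U -> U `<=` X ->
    smooth_section U s -> smooth_section U s' ->
    forall t, U t ->
      dz (fun x => Q x (s x) (s' x)) t =
        Q t (d10 d s t) (s' t) + Q t (s t) (d01 d s' t) /\
      dzbar (fun x => Q x (s x) (s' x)) t =
        Q t (d01 d s t) (s' t) + Q t (s t) (d10 d s' t).

(* The component v^{p,n-p} of v in the decomposition of E t as the sum of the
   subspaces H p t for p in ps. *)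
Definition hodge_comp (E : bundle X) (ps : seq int)
    (H : int -> forall t : C, {vspace E t}) (p : int) (t : C) : E t -> E t :=
  sumv_pi (\sum_(p' <- ps) H p' t)%VS p.

(* h(v, w) = sum over p + q = n of (-1)^q Q(v^{p,q}, w^{p,q}); it is
   sesquilinear and hermitian because Q is. *)
Definition hodge_metric (n : int) (E : bundle X) (ps : seq int)
    (H : int -> forall t : C, {vspace E t}) (Q : pairing E)
    (t : C) (v w : E t) : C :=
  \sum_(p <- ps) (-1) ^ (n - p) * Q t (hodge_comp ps H p v) (hodge_comp ps H p w).
Arguments hodge_metric n {E} ps H Q t v w.

(* A polarized complex variation of Hodge structure of weight n on X.
   hodge p t is the fibre at t of E^{p,n-p}, and hodge_types is a finite list
   of integers outside which E^{p,n-p} vanishes. *)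
Record pvhs (n : int) := PVHS {
  vhs_bundle :> bundle X;
  hodge_types : seq int;
  hodge : int -> forall t : C, {vspace vhs_bundle t};
  conn : connection vhs_bundle;
  pol : pairing vhs_bundle;
  hodge_types_uniq : uniq hodge_types;
  hodge_support : forall p t, X t -> p \notin hodge_types -> hodge p t = 0%VS;
  hodge_direct : forall t, X t ->
    directv (\sum_(p <- hodge_types) hodge p t)%VS;
  hodge_full : forall t, X t ->
    (\sum_(p <- hodge_types) hodge p t)%VS = fullv;
  hodge_smooth : forall p, smooth_subbundle (hodge p);
  conn_flat : flat conn;
  conn_hodge : forall p U s, openC U -> U `<=` X -> smooth_section U s ->
    (forall t, U t -> s t \in hodge p t) ->
    forall t, U t ->
      d10 conn s t \in (hodge p t + hodge (p - 1) t)%VS /\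
      d01 conn s t \in (hodge p t + hodge (p + 1) t)%VS;
  pol_smooth : smooth_pairing pol;
  pol_flat : flat_pairing conn pol;
  pol_ortho : forall p p' t v w, X t -> p != p' ->
    v \in hodge p t -> w \in hodge p' t -> pol t v w = 0;
  metric_smooth : smooth_pairing (hodge_metric n hodge_types hodge pol);
  metric_pos : forall t v, X t -> v != 0 ->
    0 < hodge_metric n hodge_types hodge pol t v v
}.

End Bundles.

(* Multi-valued flat sections: flat sections over half_plane of the pull-back
   of (E, d) by cexp. *)
Section MultivaluedSections.
Variables (R : realType) (X : set R[i]) (E : bundle X) (d : connection E).
Local Notation C := R[i].

(* sections of cexp^* E; only the values on half_plane matter *)
Definition msection : Type := forall z : C, E (cexp z).

(* coordinates of v in the pulled-back local frame *)
Definition mcoord (i : chart E) (k : 'I_(rank E)) (v : msection) : C -> C :=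
  fun z => triv i (cexp z) (v z) k 0.

Definition smooth_msection (v : msection) : Prop :=
  forall (i : chart E) (k : 'I_(rank E)),
    smooth_on (half_plane `&` cexp @^-1` dom i) (mcoord i k v).

(* The dz and dzbar parts of the pulled-back connection cexp^* d, computed in
   the chart i from the Leibniz rule and
   (cexp^* d) (e_k o cexp) = cexp^* (d e_k), where cexp^* dt = cexp z dz and
   cexp^* dtbar = conj (cexp z) dzbar. *)
Definition pull10 (i : chart E) (v : msection) : msection := fun z =>
  \sum_k (dz (mcoord i k v) z *: frame i k (cexp z)
    + (mcoord i k v z * cexp z) *: d10 d (frame i k) (cexp z)).

Definition pull01 (i : chart E) (v : msection) : msection := fun z =>
  \sum_k (dzbar (mcoord i k v) z *: frame i k (cexp z)
    + (mcoord i k v z * conjc (cexp z)) *: d01 d (frame i k) (cexp z)).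

(* The space V of multi-valued flat sections, as a predicate. *)
Definition flat_msection (v : msection) : Prop :=
  smooth_msection v /\
  forall (i : chart E) z, half_plane z -> dom i (cexp z) ->
    pull10 i v z = 0 /\ pull01 i v z = 0.

(* (T v) z = v (z - 2 pi i), transported from the fibre over
   cexp (z - 2 pi i) to the equal fibre over cexp z *)
Definition monodromy (v : msection) : msection := fun z =>
  ecast t (E t) (cexpB2pi z) (v (z - two_pi_i R)).

Definition monodromy_eigenvalue (lambda : C) : Prop :=
  exists v : msection,
    [/\ flat_msection v,
        (exists2 z, half_plane z & v z != 0)
      & forall z, half_plane z -> monodromy v z = lambda *: v z].

End MultivaluedSections.

(* Main.v *)
Require Import Defs.
From mathcomp Require Import all_boot all_order all_algebra sesquilinear.
From mathcomp Require Import all_classical all_reals all_analysis.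
From mathcomp Require Import complex zify ring lra.
Import Defs.

(* A flat multivalued section v with v(z - 2 pi i) = lambda v(z) has Hodge norm
   f = h(v, v) with f(z - 2 pi i) = |lambda|^2 f(z), so that f(z) e^(b y) is
   2 pi-periodic in y for b = log|lambda|^2 / (2 pi).

   Let v_p be the Hodge components of v, W_p the E^p-part of the dtbar-component
   of d v_p, and X_p the E^(p-1)-part of the dt-component of d v_p. As d v = 0,
   the signed components satisfy d_t f = 2 A and d_tbar d_t f = 2 S with
     A = sum_p +- Q(v_p, W_p) = sum_p +- Q(X_p, v_(p-1)),
     S = sum_p (|W_p|^2 + |X_p|^2).
   Averaging the two expressions of A with weights depending slightly on p gives
   f S >= 2 (1 + eps) |A|^2 for some eps > 0 depending only on the number of Hodge
   types, i.e. f lap f >= (1 + eps) |grad f|^2.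

   If b <> 0, take a small k > 0 and a strip x0 <= x <= x1 of width pi / k in the
   half-plane. With M = 1 / eps the periodic function
   f(z) e^(b y) sin(k (x1 - x))^M has an interior maximum, where the inequality
   above gives b^2 <= (M k)^2, which is false. Hence b = 0. *)

Set Implicit Arguments.
Unset Strict Implicit.
Unset Printing Implicit Defensive.

Import Order.TTheory GRing.Theory Num.Theory.
Import numFieldNormedType.Exports.

Local Open Scope classical_set_scope.
Local Open Scope ring_scope.

(** * Functions of two real variables *)

Section TwoVariables.
Variable R : realType.
Implicit Types g : R * R -> R.

(** The gain [eps] is indispensable: f = exp(- b y) satisfies f lap f = |grad f|^2 and f(z - 2 pi i)
    = exp(2 pi b) f(z), so subharmonicity of log f alone excludes nothing. With eps > 0 the
    inequality says that u = f^(- eps) is superharmonic where f > 0. This explains the test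
    function. Put w = exp(b y / M) sin(k (x1 - x)), so that lap w = ((b / M)^2 - k^2) w. For M = 1 /
    eps the function f exp(b y) sin(k (x1 - x))^M is (w / u)^M. Where w / u has an interior maximum
    c > 0, u - w / c has a local minimum, hence lap w <= c lap u <= 0 and |b| <= M k. The
    computation is done on the logarithm of the product. The obstacle is that flat sections live
    over the half-plane, whereas the connection, Q and the metric are given on the punctured disk.
    Derivatives are therefore computed in the coordinate t = e^z, through local branches of the
    logarithm; periodicity and compactness are used in the coordinate z. *)

Lemma is_derive_cvg (V : normedModType R) (f : V -> R) (p v : V) (d : R) :
  (fun h : R => h^-1 * (f (h *: v + p) - f p)) @ 0^' --> d <->
  is_derive p v f d.
Proof.
split=> [fd|[df <-]]; first by split; [exact: (cvgP d)|exact: cvg_lim].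
exact: df.
Qed.

Lemma is_derive_line_cvg (V : normedModType R) (f : V -> R) (p v : V) (d : R) :
  is_derive p v f d -> (fun h : R => f (h *: v + p)) @ 0^' --> f p.
Proof.
move=> /is_derive_cvg fd.
suff : (fun h : R => f (h *: v + p)) @ 0^' --> 0 * d + f p.
  by rewrite mul0r add0r.
apply: (@cvg_trans _ ((fun h : R => h * (h^-1 * (f (h *: v + p) - f p)) + f p)
   @ 0^')); last first.
  apply: cvgD; last exact: cvg_cst.
  by apply: cvgM => //; exact: cvg_within.
apply/near_eq_cvg; near=> h.
have h0 : h != 0 by near: h; exact: nbhs_dnbhs_neq.
by rewrite mulrA mulfV// mul1r subrK.
Unshelve. all: by end_near. Qed.

(** The quotient in the first variable is taken at the moved height [b + q.2], so its limit needs
    the partial derivative to be continuous in both variables; the remaining increment, in the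
    second variable, then starts at [(a, b)] itself. The value at [q.1 = 0] makes the increment
    formula hold without exception. *)
Definition slope1 g (a b : R) (q : R * R) : R :=
  if q.1 == 0 then 'D_(1, 0) g (a, b + q.2)
  else (g (q.1 + a, b + q.2) - g (a, b + q.2)) / q.1.

Lemma is_derive_fst g (a b : R) : derivable g (a, b) (1, 0) ->
  is_derive a 1 (fun x => g (x, b)) ('D_(1, 0) g (a, b)).
Proof.
move=> dg; apply/is_derive_cvg.
have /is_derive_cvg := derivableP dg.
apply: cvg_trans; apply/near_eq_cvg; near=> h.
congr (_ * (g _ - _)); congr (_ , _).
by rewrite /= [h *: 0](mulr0 h) add0r.
Unshelve. all: by end_near. Qed.

Lemma is_derive_snd g (a b : R) : derivable g (a, b) (0, 1) ->
  is_derive b 1 (fun x => g (a, x)) ('D_(0, 1) g (a, b)).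
Proof.
move=> dg; apply/is_derive_cvg.
have /is_derive_cvg := derivableP dg.
apply: cvg_trans; apply/near_eq_cvg; near=> h.
congr (_ * (g _ - _)); congr (_ , _).
by rewrite /= [h *: 0](mulr0 h) add0r.
Unshelve. all: by end_near. Qed.

(** By the mean value theorem the slope is the partial derivative at an intermediate point
    [(c, b + k)], which tends to [(a, b)]. *)
Lemma slope1_cvg g (a b : R) :
  (\forall q \near (a, b), derivable g q (1, 0)) ->
  continuous_at (a, b) ('D_(1, 0) g) ->
  slope1 g a b @ (0, 0) --> 'D_(1, 0) g (a, b).
Proof.
move=> dg cg; apply/cvgrPdist_lt => e e0.
have /cvgrPdist_lt/(_ _ e0) := cg => ng.
have [d /= d0 dP] : exists2 d : R, 0 < d & forall x y, `|x - a| < d ->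
    `|y - b| < d -> derivable g (x, y) (1, 0) /\
      `|'D_(1, 0) g (a, b) - 'D_(1, 0) g (x, y)| < e.
  have /nbhs_ballP[d /= d0 dP] : nbhs (a, b) [set q | derivable g q (1, 0) /\
       `|'D_(1, 0) g (a, b) - 'D_(1, 0) g q| < e] by exact: filterI.
  exists d => // x y xa yb; apply: dP.
  by split => /=; rewrite /ball /= distrC.
suff /nbhs_ballP : exists2 d : R, 0 < d & ball ((0, 0) : R * R) d `<=`
  [set q | `|'D_(1, 0) g (a, b) - slope1 g a b q| < e] by [].
exists d => // -[h k] [] /=; rewrite /ball /= !sub0r !normrN.
move=> hd kd; rewrite /slope1 /=; case: ifPn => [_|h0].
  by apply: (dP a (b + k) _ _).2; rewrite ?subrr ?normr0 // addrC addKr.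
have dg1 x : `|x - a| < d -> is_derive x 1 (fun x => g (x, b + k))
    ('D_(1, 0) g (x, b + k)).
  move=> xa; apply: is_derive_fst.
  by apply: (dP x (b + k) _ _).1 => //; rewrite addrC addKr.
have inball x : x \in `[Num.min a (h + a), Num.max a (h + a)] -> `|x - a| < d.
  rewrite in_itv /= ge_min le_max => /andP[xl xu].
  apply: le_lt_trans hd; rewrite ler_norml.
  have [h_ge0|h_lt0] := leP 0 h.
    rewrite (ger0_norm h_ge0).
    by case/orP: xl => xl; case/orP: xu => xu; apply/andP; split; lra.
  rewrite (ltr0_norm h_lt0).
  by case/orP: xl => xl; case/orP: xu => xu; apply/andP; split; lra.
have [c cI cE] : exists2 c, `|c - a| < d &
    g (h + a, b + k) - g (a, b + k) = 'D_(1, 0) g (c, b + k) * h.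
  have [ah|ha] := leP a (h + a).
    have [||c cI ->] := @MVT_segment R (fun x => g (x, b + k))
        (fun x => 'D_(1, 0) g (x, b + k)) a (h + a) ah.
    - move=> x; rewrite in_itv /= => /andP[x1 x2]; apply: dg1; apply: inball.
      by rewrite in_itv /= ge_min le_max (ltW x1) (ltW x2) orbT.
    - apply: derivable_within_continuous => x xI.
      apply: ex_derive; apply: dg1; apply: inball; move: xI.
      by rewrite !in_itv /= ge_min le_max => /andP[-> ->]; rewrite orbT.
    - exists c; last by rewrite addrK.
      apply: inball; move: cI.
      by rewrite !in_itv /= ge_min le_max => /andP[-> ->]; rewrite orbT.
  have [||c cI cE] := @MVT_segment R (fun x => g (x, b + k))
        (fun x => 'D_(1, 0) g (x, b + k)) (h + a) a (ltW ha).
  - move=> x; rewrite in_itv /= => /andP[x1 x2]; apply: dg1; apply: inball.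
    by rewrite in_itv /= ge_min le_max (ltW x1) (ltW x2) orbT.
  - apply: derivable_within_continuous => x xI.
    apply: ex_derive; apply: dg1; apply: inball; move: xI.
    by rewrite !in_itv /= ge_min le_max => /andP[-> ->]; rewrite orbT.
  - exists c; last by rewrite -opprB cE -mulrN; congr (_ * _); ring.
    apply: inball; move: cI.
    by rewrite !in_itv /= ge_min le_max => /andP[-> ->]; rewrite orbT.
rewrite cE mulfK//.
by apply: (dP c (b + k) cI _).2; rewrite addrC addKr.
Qed.

Lemma slope2_cvg g (a b : R) : derivable g (a, b) (0, 1) ->
  (fun k : R => if k == 0 then 'D_(0, 1) g (a, b)
     else k^-1 * (g (a, k + b) - g (a, b))) @ 0 --> 'D_(0, 1) g (a, b).
Proof.
move=> /is_derive_snd /is_derive_cvg gd.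
have gd' : (fun k : R => if k == 0 then 'D_(0, 1) g (a, b)
     else k^-1 * (g (a, k + b) - g (a, b))) @ 0^' --> 'D_(0, 1) g (a, b).
  apply: cvg_trans gd; apply: near_eq_cvg; near=> k.
  have k0 : k != 0 by near: k; exact: nbhs_dnbhs_neq.
  by rewrite (negbTE k0) /= [k%:A]mulr1.
move/cvgrPdist_lt : gd' => gd'; apply/cvgrPdist_lt => e e0.
have [d /= d0 dP] := gd' _ e0.
exists d => // k kd; have [k0|k0] /= := eqVneq k 0; first by rewrite subrr normr0.
by have := dP k kd k0; rewrite /= (negbTE k0).
Unshelve. all: by end_near. Qed.

(* Caratheodory's form of the chain rule: the increment of [g] is
   [slope1 * dx + slope2 * dy] with slopes continuous at the base point. *)
Lemma is_derive_comp2 (V : normedModType R) g (l m : V -> R) (p v : V) dl dm :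
  (\forall q \near (l p, m p), derivable g q (1, 0)) ->
  derivable g (l p, m p) (0, 1) ->
  continuous_at (l p, m p) ('D_(1, 0) g) ->
  is_derive p v l dl -> is_derive p v m dm ->
  is_derive p v (fun q => g (l q, m q))
    ('D_(1, 0) g (l p, m p) * dl + 'D_(0, 1) g (l p, m p) * dm).
Proof.
move=> g1 g2 g1c pl pm; apply/is_derive_cvg.
have incr (f : V -> R) d : is_derive p v f d ->
    (fun h : R => f (h *: v + p) - f p) @ 0^' --> (0 : R).
  move=> /is_derive_line_cvg fp.
  suff : (fun h : R => f (h *: v + p) - f p) @ 0^' --> f p - f p by rewrite subrr.
  by apply: cvgB => //; exact: cvg_cst.
have lm : (fun h : R => (l (h *: v + p) - l p, m (h *: v + p) - m p)) @ 0^' -->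
    ((0, 0) : R * R).
  exact: (cvg_pair (incr _ _ pl) (incr _ _ pm)).
have s1 := cvg_comp _ _ lm (slope1_cvg g1 g1c).
have s2 := cvg_comp _ _ (incr _ _ pm) (slope2_cvg g2).
apply: (@cvg_trans _ _ _ _ _ (cvgD (cvgM s1 (proj2 (is_derive_cvg _ _ _ _) pl))
  (cvgM s2 (proj2 (is_derive_cvg _ _ _ _) pm)))).
apply/near_eq_cvg; near=> h.
have h0 : h != 0 by near: h; exact: nbhs_dnbhs_neq.
rewrite /slope1 !fctE /= !subrK [m p + _]addrC subrK.
have -> : g (l (h *: v + p), m (h *: v + p)) - g (l p, m p) =
  (g (l (h *: v + p), m (h *: v + p)) - g (l p, m (h *: v + p))) +
  (g (l p, m (h *: v + p)) - g (l p, m p)) by rewrite addrA subrK.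
rewrite [RHS]mulrDr; congr (_ + _).
  case: ifPn => [/eqP l0|l0]; last by rewrite mulrCA mulfVK.
  by rewrite l0 mulr0 mulr0; move/eqP: l0; rewrite subr_eq0 => /eqP ->; rewrite subrr mulr0.
case: ifPn => [/eqP m0|m0]; last by rewrite mulrCA [_ * _ * _]mulrAC mulVf// mul1r.
by rewrite m0 mulr0 mulr0; move/eqP: m0; rewrite subr_eq0 => /eqP ->; rewrite subrr mulr0.
Unshelve. all: by end_near. Qed.

End TwoVariables.

(** * Calculus of C^k functions on the plane *)

Section CkCalculus.
Variable R : realType.
Implicit Types (U V : set (R * R)) (f g l m : R * R -> R) (k : nat).

Lemma Ck_continuous k U g p : Ck k U g -> U p -> continuous_at p g.
Proof. by case: k => [|k] [gc _]; exact: gc. Qed.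

Lemma CkS k U g : Ck k.+1 U g -> Ck k U g.
Proof.
elim: k g => [|k IH] g [gc [gd g1 g2]]; first exact: conj gc I.
exact: conj gc (And3 gd (IH _ g1) (IH _ g2)).
Qed.

(** ['D] is taken in the whole plane, so [Ck k U g] is a condition at each point of [U] separately;
    it glues and restricts over arbitrary sets. *)
Lemma Ck_local k U g : (forall p, U p -> exists2 V, V p & Ck k V g) -> Ck k U g.
Proof.
elim: k g => [|k IH] g gU.
  by split=> // p /gU[V Vp [gc _]]; exact: gc.
split; first by move=> p /gU[V Vp [gc _]]; exact: gc.
split=> [p /gU[V Vp [_ [gd _ _]]]||].
- exact: gd.
- by apply: IH => p /gU[V Vp [_ [_ g1 _]]]; exists V.
- by apply: IH => p /gU[V Vp [_ [_ _ g2]]]; exists V.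
Qed.

Lemma Ck_sub k U V g : V `<=` U -> Ck k U g -> Ck k V g.
Proof. by move=> VU gU; apply: Ck_local => p /VU Up; exists U. Qed.

Lemma near_open U (P : R * R -> Prop) p : open U -> U p ->
  (forall q, U q -> P q) -> \forall q \near p, P q.
Proof.
by move=> oU Up UP; apply: filterS UP _; exact: open_nbhs_nbhs.
Qed.

Lemma Ck_eq k U f g : open U -> (forall p, U p -> f p = g p) ->
  Ck k U f -> Ck k U g.
Proof.
move=> oU.
have cont k' f' g' p : (forall p, U p -> f' p = g' p) -> Ck k' U f' -> U p ->
    continuous_at p g'.
  move=> fg fU Up; have fp := Ck_continuous fU Up.
  rewrite /continuous_at -(fg _ Up); apply: cvg_trans fp.
  by apply: near_eq_cvg; exact: (near_open oU Up).
elim: k f g => [|k IH] f g fg fU.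
  exact: conj (fun p Up => cont _ _ _ _ fg fU Up) I.
have nfg p : U p -> {near p, f =1 g} by move=> Up; exact: (near_open oU Up).
have dfg e p (Up : U p) : 'D_e f p = 'D_e g p := near_eq_derive e (nfg p Up).
case: (fU) => _ [fd f1 f2].
refine (conj (fun p Up => cont _ _ _ _ fg fU Up)
  (And3 _ (IH _ _ (dfg _) f1) (IH _ _ (dfg _) f2))) => p Up.
have [d1 d2] := fd _ Up.
exact: conj (near_eq_derivable (nfg _ Up) d1) (near_eq_derivable (nfg _ Up) d2).
Qed.

Lemma CkSI k U g g1 g2 : open U ->
  (forall p, U p -> continuous_at p g) ->
  (forall p, U p -> is_derive p (1, 0) g (g1 p)) ->
  (forall p, U p -> is_derive p (0, 1) g (g2 p)) ->
  Ck k U g1 -> Ck k U g2 -> Ck k.+1 U g.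
Proof.
move=> oU gc d1 d2 C1 C2; split; first exact: gc.
split.
- move=> p Up; split; first by have [] := d1 p Up.
  by have [] := d2 p Up.
- by apply: Ck_eq oU _ C1 => p Up; have [] := d1 p Up.
- by apply: Ck_eq oU _ C2 => p Up; have [] := d2 p Up.
Qed.

Lemma Ck_is_derive k U g p : Ck k.+1 U g -> U p ->
  is_derive p (1, 0) g ('D_(1, 0) g p) /\ is_derive p (0, 1) g ('D_(0, 1) g p).
Proof.
move=> [_ [gd _ _]] Up; have [d1 d2] := gd p Up.
by split; [exact: (derivableP d1)|exact: (derivableP d2)].
Qed.

Lemma Ck_cst k U (c : R) : open U -> Ck k U (fun=> c).
Proof.
move=> oU; have cc p : U p -> continuous_at p (fun=> c) by move=> _; exact: cvg_cst.
elim: k c cc => [|k IH] c cc; first by split; [exact: cc|].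
have c0 p : U p -> continuous_at p (fun=> 0 : R) by move=> _; exact: cvg_cst.
by apply: (CkSI oU cc _ _ (IH 0 c0) (IH 0 c0)) => p _; exact: is_derive_cst.
Qed.

Lemma CkD k U f g : open U -> Ck k U f -> Ck k U g ->
  Ck k U (fun p => f p + g p).
Proof.
move=> oU.
have cont k' f' g' : Ck k' U f' -> Ck k' U g' -> forall p, U p ->
    continuous_at p (fun p => f' p + g' p).
  by move=> fU gU p Up; apply: cvgD; [exact: Ck_continuous fU Up|exact: Ck_continuous gU Up].
elim: k f g => [|k IH] f g fU gU; first by split; [exact: cont fU gU|].
case: (fU) (gU) => _ [_ f1 f2] [_ [_ g1 g2]].
apply: (CkSI oU (cont _ _ _ fU gU) _ _ (IH _ _ f1 g1) (IH _ _ f2 g2)) => p Up.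
  by have [d1 _] := Ck_is_derive fU Up; have [d2 _] := Ck_is_derive gU Up; exact: is_deriveD.
by have [_ d1] := Ck_is_derive fU Up; have [_ d2] := Ck_is_derive gU Up; exact: is_deriveD.
Qed.

Lemma CkM k U f g : open U -> Ck k U f -> Ck k U g ->
  Ck k U (fun p => f p * g p).
Proof.
move=> oU.
have cont k' f' g' : Ck k' U f' -> Ck k' U g' -> forall p, U p ->
    continuous_at p (fun p => f' p * g' p).
  by move=> fU gU p Up; apply: cvgM; [exact: Ck_continuous fU Up|exact: Ck_continuous gU Up].
elim: k f g => [|k IH] f g fU gU; first by split; [exact: cont fU gU|].
case: (fU) (gU) => _ [_ f1 f2] [_ [_ g1 g2]].
apply: (CkSI oU (cont _ _ _ fU gU) _ _
  (CkD oU (IH _ _ (CkS fU) g1) (IH _ _ (CkS gU) f1))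
  (CkD oU (IH _ _ (CkS fU) g2) (IH _ _ (CkS gU) f2))) => p Up.
  by have [d1 _] := Ck_is_derive fU Up; have [d2 _] := Ck_is_derive gU Up; exact: is_deriveM.
by have [_ d1] := Ck_is_derive fU Up; have [_ d2] := Ck_is_derive gU Up; exact: is_deriveM.
Qed.

Lemma CkN k U f : open U -> Ck k U f -> Ck k U (fun p => - f p).
Proof.
move=> oU fU; apply: (Ck_eq oU _ (CkM oU (Ck_cst k (-1) oU) fU)) => p _.
exact: mulN1r.
Qed.

Lemma is_deriveV_fun f (p e : R * R) df : f p != 0 -> is_derive p e f df ->
  is_derive p e (fun q => (f q)^-1) (- ((f p)^-1 * (f p)^-1 * df)).
Proof.
move=> fp [fd <-]; split; first exact: derivableV.
by rewrite [LHS]deriveV// -exprVn expr2 [LHS]mulNr.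
Qed.

Lemma CkV k U f : open U -> (forall p, U p -> f p != 0) -> Ck k U f ->
  Ck k U (fun p => (f p)^-1).
Proof.
move=> oU f0.
have cont k' : Ck k' U f -> forall p, U p -> continuous_at p (fun p => (f p)^-1).
  by move=> fU p Up; apply: cvgV; [exact: f0|exact: Ck_continuous fU Up].
elim: k => [|k IH] fU; first by split; [exact: cont fU|].
have fk := IH (CkS fU); case: (fU) => _ [_ f1 f2].
apply: (CkSI oU (cont _ fU) _ _ (CkN oU (CkM oU (CkM oU fk fk) f1))
   (CkN oU (CkM oU (CkM oU fk fk) f2))) => p Up.
  by have [d1 _] := Ck_is_derive fU Up; apply: is_deriveV_fun (f0 _ Up) d1.
by have [_ d1] := Ck_is_derive fU Up; apply: is_deriveV_fun (f0 _ Up) d1.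
Qed.

Lemma Ck_is_derive_comp k U V g l m p e dl dm :
  open V -> (forall q, U q -> V (l q, m q)) -> U p ->
  Ck k.+1 V g -> is_derive p e l dl -> is_derive p e m dm ->
  is_derive p e (fun q => g (l q, m q))
    ('D_(1, 0) g (l p, m p) * dl + 'D_(0, 1) g (l p, m p) * dm).
Proof.
move=> oV UV Up [_ [gd g1 _]] lp mp; have Vp := UV _ Up.
apply: (is_derive_comp2 _ (gd _ Vp).2 _ lp mp).
  exact: (near_open oV Vp (fun q Vq => (gd q Vq).1)).
exact: Ck_continuous g1 Vp.
Qed.

Lemma Ck_comp2 k U V g l m : open U -> open V ->
  (forall p, U p -> V (l p, m p)) ->
  Ck k V g -> Ck k U l -> Ck k U m -> Ck k U (fun p => g (l p, m p)).
Proof.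
move=> oU oV UV.
have cont k' g' : Ck k' V g' -> Ck k' U l -> Ck k' U m -> forall p, U p ->
    continuous_at p (fun p => g' (l p, m p)).
  move=> gV lU mU p Up.
  have lm : (fun p => (l p, m p)) @ p --> (l p, m p).
    exact: cvg_pair (Ck_continuous lU Up) (Ck_continuous mU Up).
  exact: cvg_comp lm (Ck_continuous gV (UV _ Up)).
elim: k g => [|k IH] g gV lU mU; first by split; [exact: cont gV lU mU|].
have [lk mk] := (CkS lU, CkS mU).
case: (lU) (mU) (gV) => _ [_ l1 l2] [_ [_ m1 m2]] [_ [_ g1 g2]].
apply: (CkSI oU (cont _ _ gV lU mU) _ _
  (CkD oU (CkM oU (IH _ g1 lk mk) l1) (CkM oU (IH _ g2 lk mk) m1))
  (CkD oU (CkM oU (IH _ g1 lk mk) l2) (CkM oU (IH _ g2 lk mk) m2))) => p Up.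
  have [d1 _] := Ck_is_derive lU Up; have [d2 _] := Ck_is_derive mU Up.
  exact: Ck_is_derive_comp oV UV Up gV d1 d2.
have [_ d1] := Ck_is_derive lU Up; have [_ d2] := Ck_is_derive mU Up.
exact: Ck_is_derive_comp oV UV Up gV d1 d2.
Qed.

Lemma is_derive_fst_proj (p v : R * R) : is_derive p v fst v.1.
Proof.
apply/is_derive_cvg; apply: (@cvg_trans _ ((fun=> v.1) @ (0 : R)^')); last exact: cvg_cst.
apply/near_eq_cvg; near=> h.
have h0 : h != 0 by near: h; exact: nbhs_dnbhs_neq.
by rewrite /= addrK mulKf.
Unshelve. all: by end_near. Qed.

Lemma is_derive_snd_proj (p v : R * R) : is_derive p v snd v.2.
Proof.
apply/is_derive_cvg; apply: (@cvg_trans _ ((fun=> v.2) @ (0 : R)^')); last exact: cvg_cst.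
apply/near_eq_cvg; near=> h.
have h0 : h != 0 by near: h; exact: nbhs_dnbhs_neq.
by rewrite /= addrK mulKf.
Unshelve. all: by end_near. Qed.

Lemma Ck_linear k U (f : R * R -> R) (c : R * R -> R) : open U -> continuous f ->
  (forall p e, is_derive p e f (c e)) -> Ck k U f.
Proof.
move=> oU fc fd; have fc' p : U p -> continuous_at p f by move=> _; exact: fc.
case: k => [|k]; first by split; [exact: fc'|].
by apply: (CkSI oU fc' _ _ (Ck_cst k (c (1, 0)) oU) (Ck_cst k (c (0, 1)) oU)) => p _; exact: fd.
Qed.

Lemma Ck_fst k U : open U -> Ck k U fst.
Proof.
move=> oU; apply: (Ck_linear k oU _ is_derive_fst_proj) => p; exact: cvg_fst.
Qed.

Lemma Ck_snd k U : open U -> Ck k U snd.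
Proof.
move=> oU; apply: (Ck_linear k oU _ is_derive_snd_proj) => p; exact: cvg_snd.
Qed.

End CkCalculus.

(** * Smooth complex functions and the Wirtinger operators *)

Section SmoothComplexFunctions.
Variable R : realType.
Local Notation C := R[i].
Local Notation Re := (@complex.Re _).
Local Notation Im := (@complex.Im _).
Implicit Types (U V : set C) (f g : C -> C).

Lemma complex_ReM (x y : C) : Re (x * y) = Re x * Re y - Im x * Im y.
Proof. by case: x y => ? ? []. Qed.

Lemma complex_ImM (x y : C) : Im (x * y) = Re x * Im y + Im x * Re y.
Proof. by case: x y => ? ? []. Qed.

Lemma complexE (x : C) : x = (Re x +i* Im x)%C.
Proof. by case: x. Qed.

Lemma openCI U V : openC U -> openC V -> openC (U `&` V).
Proof. by move=> oU oV; exact: (openI oU oV). Qed.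

Lemma openC_near U (t : C) (P : R * R -> Prop) : openC U -> U t ->
  (forall q, U (q.1 +i* q.2)%C -> P q) -> \forall q \near (Re t, Im t), P q.
Proof. by move=> oU Ut; apply: near_open; rewrite // /plane /= -complexE. Qed.

Lemma smooth_local U f :
  (forall t, U t -> exists2 V, V t & smooth_on V f) -> smooth_on U f.
Proof.
move=> fU k; split; apply: Ck_local => p Up; have [V Vp fV] := fU _ Up;
  exists (plane V) => //; by have [] := fV k.
Qed.

Lemma smooth_sub U V f : V `<=` U -> smooth_on U f -> smooth_on V f.
Proof. by move=> VU fU; apply: smooth_local => t /VU Ut; exists U. Qed.

Lemma smooth_eq U f g : openC U -> (forall t, U t -> f t = g t) ->
  smooth_on U f -> smooth_on U g.
Proof.
move=> oU fg fU k; have [f1 f2] := fU k.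
by split; [apply: Ck_eq oU _ f1 | apply: Ck_eq oU _ f2] => p Up;
  rewrite /re_fun /im_fun fg.
Qed.

Lemma smooth_cst U (c : C) : openC U -> smooth_on U (fun=> c).
Proof. by move=> oU k; split; exact: Ck_cst. Qed.

Lemma smoothD U f g : openC U -> smooth_on U f -> smooth_on U g ->
  smooth_on U (fun t => f t + g t).
Proof.
move=> oU fU gU k; have [f1 f2] := fU k; have [g1 g2] := gU k; split.
  apply: (Ck_eq oU _ (CkD oU f1 g1)) => p _.
  by rewrite /re_fun; case: (f _) (g _) => ? ? [].
apply: (Ck_eq oU _ (CkD oU f2 g2)) => p _.
by rewrite /im_fun; case: (f _) (g _) => ? ? [].
Qed.

Lemma smoothM U f g : openC U -> smooth_on U f -> smooth_on U g ->
  smooth_on U (fun t => f t * g t).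
Proof.
move=> oU fU gU k; have [f1 f2] := fU k; have [g1 g2] := gU k; split.
  apply: (Ck_eq oU _ (CkD oU (CkM oU f1 g1) (CkN oU (CkM oU f2 g2)))) => p _.
  by rewrite /re_fun complex_ReM.
apply: (Ck_eq oU _ (CkD oU (CkM oU f1 g2) (CkM oU f2 g1))) => p _.
by rewrite /im_fun complex_ImM.
Qed.

Lemma smoothV U f : openC U -> (forall t, U t -> f t != 0) -> smooth_on U f ->
  smooth_on U (fun t => (f t)^-1).
Proof.
move=> oU f0 fU k; have [f1 f2] := fU k.
have n0 p : plane U p -> re_fun f p * re_fun f p + im_fun f p * im_fun f p != 0.
  move=> Up; have := f0 _ Up; rewrite /re_fun /im_fun; case: (f _) => a b /=.
  apply: contra; rewrite -!expr2 paddr_eq0 ?sqr_ge0// !sqrf_eq0.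
  by rewrite eq_complex.
have nV := CkV oU n0 (CkD oU (CkM oU f1 f1) (CkM oU f2 f2)).
split.
  apply: (Ck_eq oU _ (CkM oU f1 nV)) => p _.
  by rewrite /re_fun /im_fun; case: (f _) => a b; rewrite /= -!expr2.
apply: (Ck_eq oU _ (CkN oU (CkM oU f2 nV))) => p _.
by rewrite /re_fun /im_fun; case: (f _) => a b; rewrite /= -!expr2 -mulNr.
Qed.

Lemma smooth_sum (I : Type) (r : seq I) (P : pred I) U (F : I -> C -> C) :
  openC U -> (forall i, P i -> smooth_on U (F i)) ->
  smooth_on U (fun t => \sum_(i <- r | P i) F i t).
Proof.
move=> oU FU; elim: r => [|i r IH].
  by apply: (smooth_eq oU _ (smooth_cst 0 oU)) => t _; rewrite big_nil.
have [Pi|nPi] := boolP (P i).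
  apply: (smooth_eq oU _ (smoothD oU (FU i Pi) IH)) => t _.
  by rewrite big_cons Pi.
by apply: (smooth_eq oU _ IH) => t _; rewrite big_cons (negbTE nPi).
Qed.

Lemma smooth_prod (I : Type) (r : seq I) (P : pred I) U (F : I -> C -> C) :
  openC U -> (forall i, P i -> smooth_on U (F i)) ->
  smooth_on U (fun t => \prod_(i <- r | P i) F i t).
Proof.
move=> oU FU; elim: r => [|i r IH].
  by apply: (smooth_eq oU _ (smooth_cst 1 oU)) => t _; rewrite big_nil.
have [Pi|nPi] := boolP (P i).
  apply: (smooth_eq oU _ (smoothM oU (FU i Pi) IH)) => t _.
  by rewrite big_cons Pi.
by apply: (smooth_eq oU _ IH) => t _; rewrite big_cons (negbTE nPi).
Qed.

Lemma smooth_det n U (A : C -> 'M[C]_n) : openC U ->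
  (forall i j, smooth_on U (fun t => A t i j)) ->
  smooth_on U (fun t => \det (A t)).
Proof.
move=> oU AU; apply: smooth_sum => // s _.
apply: smoothM => //; first exact: smooth_cst.
by apply: smooth_prod => // i _; exact: AU.
Qed.

(** Cramer's formula: an entry of the inverse is a cofactor divided by the determinant, both
    polynomial in the entries. *)
Lemma smooth_invmx n U (A : C -> 'M[C]_n) : openC U ->
  (forall i j, smooth_on U (fun t => A t i j)) ->
  (forall t, U t -> A t \in unitmx) ->
  forall i j, smooth_on U (fun t => invmx (A t) i j).
Proof.
move=> oU AU Au i j.
have adjU : smooth_on U (fun t => (\adj (A t)) i j).
  have : smooth_on U (fun t => cofactor (A t) j i).
    apply: smoothM => //; first exact: smooth_cst.
    apply: smooth_det => // i' j'.
    by apply: (smooth_eq oU _ (AU (lift j i') (lift i j'))) => t _; rewrite !mxE.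
  by apply: smooth_eq => // t Ut; rewrite mxE.
have detU : smooth_on U (fun t => (\det (A t))^-1).
  by apply: smoothV; [|by move=> t /Au; rewrite unitmxE unitfE|exact: smooth_det].
apply: (smooth_eq oU _ (smoothM oU detU adjU)) => t Ut.
by rewrite /invmx (Au _ Ut) [RHS]mxE.
Qed.

Lemma pderiv_eq U f g (e : R * R) t : openC U -> U t ->
  (forall x, U x -> f x = g x) -> pderiv e f t = pderiv e g t.
Proof.
move=> oU Ut fg; congr (_ +i* _)%C; apply: near_eq_derive;
  apply: (openC_near oU Ut) => q Uq; by rewrite /re_fun /im_fun fg.
Qed.

Lemma dz_eq U f g t : openC U -> U t -> (forall x, U x -> f x = g x) ->
  dz f t = dz g t.
Proof. by move=> oU Ut fg; rewrite /dz !(pderiv_eq _ oU Ut fg). Qed.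

Lemma dzbar_eq U f g t : openC U -> U t -> (forall x, U x -> f x = g x) ->
  dzbar f t = dzbar g t.
Proof. by move=> oU Ut fg; rewrite /dzbar !(pderiv_eq _ oU Ut fg). Qed.

Lemma pderiv_cst (c : C) e t : pderiv e (fun=> c) t = 0.
Proof. by rewrite /pderiv /re_fun /im_fun !derive_cst. Qed.

Lemma dz_cst (c : C) t : dz (fun=> c) t = 0.
Proof. by rewrite /dz !pderiv_cst mulr0 subr0 mul0r. Qed.

Lemma dzbar_cst (c : C) t : dzbar (fun=> c) t = 0.
Proof. by rewrite /dzbar !pderiv_cst mulr0 addr0 mul0r. Qed.

End SmoothComplexFunctions.

(** * The logarithm as a chart of the punctured disk *)

Section LogarithmicChart.
Variable R : realType.
Local Notation C := R[i].
Local Notation Re := (@complex.Re _).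
Local Notation Im := (@complex.Im _).

Lemma is_derive_line (V : normedModType R) (f : V -> R) (p v : V) (d : R) :
  is_derive p v f d <-> is_derive (0 : R) 1 (fun h : R => f (h *: v + p)) d.
Proof.
rewrite -!is_derive_cvg scale0r add0r.
by under [X in _ <-> X @ _ --> _]eq_fun do rewrite addr0 [_ *: 1]mulr1.
Qed.

Lemma is_derive_comp1 (V : normedModType R) (phi : R -> R) (f : V -> R) (p v : V)
    (df dphi : R) :
  is_derive p v f df -> is_derive (f p) 1 phi dphi ->
  is_derive p v (fun q => phi (f q)) (dphi * df).
Proof.
move=> /is_derive_line fd phid; apply/is_derive_line.
apply: (@is_derive1_comp R phi (fun h => f (h *: v + p))) fd.
by rewrite scale0r add0r.
Qed.

(** [rot1] and [rot2] are the real and imaginary parts of e^(- i y0) p: the ray of argument [y0] is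
    turned onto the positive real axis, where the argument is the arctangent of the slope. *)
Definition rot1 (y0 : R) (p : R * R) : R := p.1 * cos y0 + p.2 * sin y0.
Definition rot2 (y0 : R) (p : R * R) : R := p.2 * cos y0 - p.1 * sin y0.
Definition lograd (p : R * R) : R := ln (p.1 ^+ 2 + p.2 ^+ 2) / 2.
Definition logarg (y0 : R) (p : R * R) : R := y0 + atan (rot2 y0 p / rot1 y0 p).
(* The half-plane centred at the ray of argument [y0], on which
   [lograd + i logarg y0] is a logarithm. *)
Definition logdom (y0 : R) : set C := [set t | 0 < rot1 y0 (Re t, Im t)].

Lemma rot_norm y0 p : rot1 y0 p ^+ 2 + rot2 y0 p ^+ 2 = p.1 ^+ 2 + p.2 ^+ 2.
Proof.
rewrite /rot1 /rot2; have := cos2Dsin2 y0.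
move: (cos y0) (sin y0) => c s cs.
transitivity ((p.1 ^+ 2 + p.2 ^+ 2) * (c ^+ 2 + s ^+ 2)); first by ring.
by rewrite cs mulr1.
Qed.

Lemma logdom_norm_gt0 y0 p : plane (logdom y0) p -> 0 < p.1 ^+ 2 + p.2 ^+ 2.
Proof.
rewrite /plane /logdom /= => p0; rewrite -(rot_norm y0).
by rewrite ltr_pwDl ?sqr_ge0 ?exprn_gt0//; case: p p0.
Qed.

Lemma Ck_rot1 k U y0 : open U -> Ck k U (rot1 y0).
Proof.
move=> oU.
exact: CkD oU (CkM oU (Ck_fst k oU) (Ck_cst k _ oU)) (CkM oU (Ck_snd k oU) (Ck_cst k _ oU)).
Qed.

Lemma Ck_rot2 k U y0 : open U -> Ck k U (rot2 y0).
Proof.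
move=> oU.
exact: CkD oU (CkM oU (Ck_snd k oU) (Ck_cst k _ oU))
  (CkN oU (CkM oU (Ck_fst k oU) (Ck_cst k _ oU))).
Qed.

Lemma openC_logdom y0 : openC (logdom y0).
Proof.
rewrite /openC (_ : plane _ = rot1 y0 @^-1` [set x | 0 < x]); last first.
  by apply/seteqP; split=> -[].
apply: open_comp; last exact: open_gt.
by move=> p _; apply: (Ck_continuous (Ck_rot1 0 y0 (@openT _))).
Qed.

Lemma is_derive_lograd (p e : R * R) : 0 < p.1 ^+ 2 + p.2 ^+ 2 ->
  is_derive p e lograd ((p.1 * e.1 + p.2 * e.2) / (p.1 ^+ 2 + p.2 ^+ 2)).
Proof.
move=> p0.
have d1 := is_derive_fst_proj p e; have d2 := is_derive_snd_proj p e.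
have dn := is_deriveD (is_deriveM d1 d1) (is_deriveM d2 d2).
have p0' : 0 < (fst * fst + snd * snd : R * R -> R) p by rewrite -!expr2 in p0 *.
have D := is_deriveM (is_derive_comp1 dn (is_derive1_ln p0')) (is_derive_cst (2^-1 : R) p e).
suff -> : lograd = (fun q => ln ((fst * fst + snd * snd : R * R -> R) q)) * cst 2^-1.
  apply: is_derive_eq D _.
  rewrite /= !fctE -!expr2 /GRing.scale /=; have := lt0r_neq0 p0.
  by move: (p.1) (p.2) (e.1) (e.2) => a b c d ab; field.
by apply/funext => q; rewrite /lograd !fctE -!expr2.
Qed.

Lemma is_derive_logarg (y0 : R) (p e : R * R) : plane (logdom y0) p ->
  is_derive p e (logarg y0) ((p.1 * e.2 - p.2 * e.1) / (p.1 ^+ 2 + p.2 ^+ 2)).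
Proof.
move=> p0; have a0 : 0 < rot1 y0 p by case: p p0.
have n0 := logdom_norm_gt0 p0.
have lin (c s : R) : is_derive p e (fun q => q.1 * c + q.2 * s) (e.1 * c + e.2 * s).
  have D := is_deriveD (is_deriveM (is_derive_fst_proj p e) (is_derive_cst (c : R) p e))
    (is_deriveM (is_derive_snd_proj p e) (is_derive_cst (s : R) p e)).
  by apply: is_derive_eq D _; rewrite /GRing.scale /=; ring.
have d1 : is_derive p e (rot1 y0) (rot1 y0 e) := lin _ _.
have d2 : is_derive p e (rot2 y0) (rot2 y0 e).
  have := lin (- sin y0) (cos y0); rewrite (_ : (fun q => _) = rot2 y0).
    by move=> D; apply: is_derive_eq D _; rewrite /rot2; ring.
  by apply/funext => q; rewrite /rot2; ring.
have dq := is_deriveM d2 (is_deriveV_fun (lt0r_neq0 a0) d1).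
have := is_deriveD (is_derive_cst (y0 : R) p e) (is_derive_comp1 dq (is_derive1_atan _)).
move=> D; apply: is_derive_eq D _.
rewrite /= !fctE /GRing.scale /= -(rot_norm y0) add0r.
(* The rotation has determinant 1 and preserves the area form; this is why the derivative of the
   argument does not depend on [y0]. *)
have -> : p.1 * e.2 - p.2 * e.1 = rot1 y0 p * rot2 y0 e - rot2 y0 p * rot1 y0 e.
  rewrite /rot1 /rot2; have := cos2Dsin2 y0.
  move: (cos y0) (sin y0) => c s cs.
  transitivity ((p.1 * e.2 - p.2 * e.1) * (c ^+ 2 + s ^+ 2)); last by ring.
  by rewrite cs mulr1.
move: n0; rewrite -(rot_norm y0).
move: (rot1 y0 p) (rot2 y0 p) (rot1 y0 e) (rot2 y0 e) a0 => a b a' b' a0 n0.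
have na : a != 0 by rewrite lt0r_neq0.
have nn : a ^+ 2 + b ^+ 2 != 0 by rewrite lt0r_neq0.
by field; rewrite na nn.
Qed.

End LogarithmicChart.

(** * The exponential map and the branches of its inverse *)

Section ExponentialAndLogarithm.
Variable R : realType.
Local Notation C := R[i].
Local Notation Re := (@complex.Re _).
Local Notation Im := (@complex.Im _).

Lemma Ck_lograd k y0 : Ck k (plane (logdom y0)) (@lograd R).
Proof.
have oU : open (plane (@logdom R y0)) by exact: openC_logdom.
have nC k' : Ck k' (plane (logdom y0)) (fun p => p.1 * p.1 + p.2 * p.2).
  by apply: CkD => //; apply: CkM => //; [exact: Ck_fst|exact: Ck_fst|exact: Ck_snd|exact: Ck_snd].
have n0 p : plane (logdom y0) p -> p.1 * p.1 + p.2 * p.2 != 0.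
  by move=> /logdom_norm_gt0/lt0r_neq0; rewrite !expr2.
have lc p : plane (logdom y0) p -> continuous_at p (@lograd R).
  move=> Up; apply: cvgM; last exact: cvg_cst.
  have nc : (fun p : R * R => p.1 ^+ 2 + p.2 ^+ 2) @ p --> p.1 ^+ 2 + p.2 ^+ 2.
    exact: (Ck_continuous (nC 0%N) Up).
  exact: (cvg_comp _ _ nc (continuous_ln (logdom_norm_gt0 Up))).
case: k => [|k]; first by split; [exact: lc|].
have dl p e (Up : plane (logdom y0) p) := is_derive_lograd e (logdom_norm_gt0 Up).
apply: (CkSI oU lc (fun p Up => dl p _ Up) (fun p Up => dl p _ Up)).
  apply: (Ck_eq oU _ (CkM oU (Ck_fst k oU) (CkV oU n0 (nC k)))) => p _.
  by rewrite !expr2 mulr1 mulr0 addr0.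
apply: (Ck_eq oU _ (CkM oU (Ck_snd k oU) (CkV oU n0 (nC k)))) => p _.
by rewrite !expr2 mulr1 mulr0 add0r.
Qed.

Lemma Ck_logarg k y0 : Ck k (plane (logdom y0)) (@logarg R y0).
Proof.
have oU : open (plane (@logdom R y0)) by exact: openC_logdom.
have nC k' : Ck k' (plane (logdom y0)) (fun p => p.1 * p.1 + p.2 * p.2).
  by apply: CkD => //; apply: CkM => //; [exact: Ck_fst|exact: Ck_fst|exact: Ck_snd|exact: Ck_snd].
have n0 p : plane (logdom y0) p -> p.1 * p.1 + p.2 * p.2 != 0.
  by move=> /logdom_norm_gt0/lt0r_neq0; rewrite !expr2.
have r0 p : plane (logdom y0) p -> rot1 y0 p != 0.
  by case: p => a b Up; rewrite lt0r_neq0.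
have lc p : plane (logdom y0) p -> continuous_at p (@logarg R y0).
  move=> Up; apply: cvgD; first exact: cvg_cst.
  have qc := Ck_continuous (CkM oU (Ck_rot2 0 y0 oU) (CkV oU r0 (Ck_rot1 0 y0 oU))) Up.
  exact: (cvg_comp _ _ qc (@continuous_atan _ _)).
case: k => [|k]; first by split; [exact: lc|].
have dl p e (Up : plane (logdom y0) p) := is_derive_logarg e Up.
apply: (CkSI oU lc (fun p Up => dl p _ Up) (fun p Up => dl p _ Up)).
  apply: (Ck_eq oU _ (CkN oU (CkM oU (Ck_snd k oU) (CkV oU n0 (nC k))))) => p _.
  by rewrite !expr2 mulr1 mulr0 sub0r mulNr.
apply: (Ck_eq oU _ (CkM oU (Ck_fst k oU) (CkV oU n0 (nC k)))) => p _.
by rewrite !expr2 mulr1 mulr0 subr0.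
Qed.

Definition clog (y0 : R) (t : C) : C :=
  (lograd (Re t, Im t) +i* logarg y0 (Re t, Im t))%C.

Lemma smooth_comp_clog y0 (U V : set C) g : openC U -> openC V ->
  U `<=` logdom y0 -> (forall t, U t -> V (clog y0 t)) ->
  smooth_on V g -> smooth_on U (fun t => g (clog y0 t)).
Proof.
move=> oU oV UL UV gV k; have [g1 g2] := gV k.
have sub : plane U `<=` plane (logdom y0) by move=> p; exact: UL.
have cc := @Ck_comp2 _ k (plane U) (plane V) _ (@lograd R) (@logarg R y0) oU oV
  (fun p Up => UV _ Up) _ (Ck_sub sub (Ck_lograd _ _)) (Ck_sub sub (Ck_logarg _ _)).
by split; [exact: cc g1|exact: cc g2].
Qed.

Lemma pderiv_comp_clog y0 (U V : set C) g t e :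
  openC V -> U `<=` logdom y0 -> (forall t, U t -> V (clog y0 t)) ->
  smooth_on V g -> U t ->
  pderiv e (fun t => g (clog y0 t)) t =
    pderiv (1, 0) g (clog y0 t) *
      ((Re t * e.1 + Im t * e.2) / (Re t ^+ 2 + Im t ^+ 2))%:C%C +
    pderiv (0, 1) g (clog y0 t) *
      ((Re t * e.2 - Im t * e.1) / (Re t ^+ 2 + Im t ^+ 2))%:C%C.
Proof.
move=> oV UL UV gV Ut; have [g1 g2] := gV 1%N.
have Up : plane U (Re t, Im t) by rewrite /plane /= -complexE.
have Lt : plane (logdom y0) (Re t, Im t) by rewrite /plane /= -complexE; exact: UL.
have dl := is_derive_lograd e (logdom_norm_gt0 Lt).
have dm := is_derive_logarg e Lt.
have UV' q : plane U q -> plane V (lograd q, logarg y0 q).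
  by case: q => a b; exact: UV.
have D h : Ck 1 (plane V) h ->
    'D_e (fun q => h (lograd q, logarg y0 q)) (Re t, Im t) =
    'D_(1, 0) h (lograd (Re t, Im t), logarg y0 (Re t, Im t)) *
      ((Re t * e.1 + Im t * e.2) / (Re t ^+ 2 + Im t ^+ 2)) +
    'D_(0, 1) h (lograd (Re t, Im t), logarg y0 (Re t, Im t)) *
      ((Re t * e.2 - Im t * e.1) / (Re t ^+ 2 + Im t ^+ 2)).
  by move=> hV; have [_] := Ck_is_derive_comp oV UV' Up hV dl dm.
rewrite {1}/pderiv.
rewrite [X in (X +i* _)%C](_ : _ = 'D_e (fun q => re_fun g (lograd q, logarg y0 q)) (Re t, Im t)); last by [].
rewrite [X in (_ +i* X)%C](_ : _ = 'D_e (fun q => im_fun g (lograd q, logarg y0 q)) (Re t, Im t)); last by [].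
rewrite (D _ g1) (D _ g2) /pderiv /clog.
by apply/eqP; rewrite eq_complex /= !mulr0 !subr0 !add0r !eqxx.
Qed.

(** The branch is holomorphic with derivative 1 / t, so the two types do not mix. The factors 1 / t
    and 1 / conj t are inverse to the factors [cexp z] and [conjc (cexp z)] in [pull10] and
    [pull01]. *)
Lemma dz_comp_clog y0 (U V : set C) g t :
  openC V -> U `<=` logdom y0 -> (forall t, U t -> V (clog y0 t)) ->
  smooth_on V g -> U t ->
  dz (fun t => g (clog y0 t)) t = dz g (clog y0 t) / t /\
  dzbar (fun t => g (clog y0 t)) t = dzbar g (clog y0 t) / conjc t.
Proof.
move=> oV UL UV gV Ut.
have Lt : plane (logdom y0) (Re t, Im t) by rewrite /plane /= -complexE; exact: UL.
have n0 := lt0r_neq0 (logdom_norm_gt0 Lt).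
have P e := pderiv_comp_clog e oV UL UV gV Ut.
have h2 : (2%:R : C)^-1 = (2^-1)%:C%C by rewrite -[2%:R](rmorph_nat (real_complex R)) -fmorphV.
rewrite /dz /dzbar !P /= !h2 !mulr1 !mulr0 !addr0 !add0r !subr0.
move: (pderiv (1, 0) g _) (pderiv (0, 1) g _) n0 => {P Lt Ut}.
case: t => p q [a b] [c d] /= n0.
split; apply/eqP; rewrite eq_complex /=; apply/andP; split; apply/eqP; rewrite ?sqrrN; field; exact: n0.
Qed.

Lemma cexp_clog y0 t : logdom y0 t -> cexp (clog y0 t) = t.
Proof.
move=> Lt; have Lp : plane (logdom y0) (Re t, Im t) by rewrite /plane /= -complexE.
have n0 := logdom_norm_gt0 Lp; rewrite /logdom /= in Lt.
rewrite /cexp /clog /= /logarg cosD sinD.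
set a := rot1 y0 _ in Lt *; set b := rot2 y0 _.
set e := expR _; set c := cos (atan _); set s := sin (atan _).
have c0 : 0 < c by apply: cos_gt0_pihalf; rewrite atan_gtNpi2 atan_ltpi2.
have e0 : 0 < e := expR_gt0 _.
have e2 : e ^+ 2 = a ^+ 2 + b ^+ 2.
  rewrite rot_norm /= -[RHS]lnK ?posrE// /e /lograd -expRM_natl; congr expR.
  by rewrite mulrC divfK.
have sc : s * a = c * b.
  have := atanK (b / a); rewrite /tan -/c -/s => /(congr1 (fun x => x * (c * a))).
  rewrite mulrA divfK ?lt0r_neq0// => ->; rewrite [c * a]mulrC mulrA divfK ?lt0r_neq0//.
  exact: mulrC.
have cs : c ^+ 2 + s ^+ 2 = 1 := cos2Dsin2 _.
(* The squares of [e * c] and [a] agree by [sc] and [cs]; positivity of [c] and [a] fixes the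
   sign. *)
have ec : e * c = a.
  apply/eqP; rewrite -(@eqrXn2 _ 2)// ?mulr_ge0 ?ltW//.
  rewrite exprMn e2 mulrDl -!exprMn [b * c]mulrC -sc !exprMn.
  by rewrite [s ^+ 2 * _]mulrC -mulrDr cs mulr1.
have es : e * s = b.
  apply: (mulIf (lt0r_neq0 Lt)); rewrite -mulrA sc mulrA ec; exact: mulrC.
have cs0 := cos2Dsin2 y0.
rewrite [RHS]complexE; apply/eqP; rewrite eq_complex /= !mul0r subr0 addr0.
have -> : e * (cos y0 * c - sin y0 * s) = cos y0 * (e * c) - sin y0 * (e * s) by ring.
have -> : e * (sin y0 * c + cos y0 * s) = sin y0 * (e * c) + cos y0 * (e * s) by ring.
rewrite ec es /a /b /rot1 /rot2 /=.
move: cs0; move: (cos y0) (sin y0) => u v uv.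
apply/andP; split; apply/eqP.
  by transitivity (Re t * (u ^+ 2 + v ^+ 2)); [ring|rewrite uv mulr1].
by transitivity (Im t * (u ^+ 2 + v ^+ 2)); [ring|rewrite uv mulr1].
Qed.

Lemma cexpE (z : C) : cexp z = (expR (Re z) * cos (Im z) +i* (expR (Re z) * sin (Im z)))%C.
Proof. by rewrite /cexp; apply/eqP; rewrite eq_complex /= !mul0r subr0 addr0 !eqxx. Qed.

Lemma rot_cexp y0 (z : C) :
  rot1 y0 (Re (cexp z), Im (cexp z)) = expR (Re z) * cos (Im z - y0) /\
  rot2 y0 (Re (cexp z), Im (cexp z)) = expR (Re z) * sin (Im z - y0).
Proof. by rewrite cexpE /rot1 /rot2 /= cosB sinB; split; ring. Qed.

Lemma logdom_cexp y0 (z : C) : `|Im z - y0| < pi / 2 -> logdom y0 (cexp z).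
Proof.
rewrite ltr_norml /logdom /= (rot_cexp y0 z).1 => zy.
by rewrite mulr_gt0 ?expR_gt0 ?cos_gt0_pihalf.
Qed.

Lemma clog_cexp y0 (z : C) : `|Im z - y0| < pi / 2 -> clog y0 (cexp z) = z.
Proof.
move=> zy; rewrite /clog /logarg (rot_cexp y0 z).1 (rot_cexp y0 z).2.
rewrite -mulf_div divff ?lt0r_neq0 ?expR_gt0// mul1r tanK; last first.
  by rewrite in_itv /= -ltr_norml.
rewrite /lograd cexpE /= !exprMn -mulrDr cos2Dsin2 mulr1 lnXn ?expR_gt0// expRK.
rewrite [RHS]complexE; apply/eqP; rewrite eq_complex /= -[Re z *+ 2]mulr_natr mulfK//.
by rewrite addrC subrK !eqxx.
Qed.

Lemma norm_cexp (z : C) : `|cexp z| = (expR (Re z))%:C%C.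
Proof.
rewrite normc_def cexpE /= !exprMn -mulrDr cos2Dsin2 mulr1.
by rewrite sqrtr_sqr ger0_norm ?expR_ge0.
Qed.

Lemma punctured_disk_cexp (z : C) : punctured_disk (cexp z) <-> half_plane z.
Proof.
rewrite /punctured_disk /half_plane /= norm_cexp.
rewrite (_ : 0 = 0%:C%C)// (_ : 1 = 1%:C%C)// !ltcR expR_gt0 /= expR_lt1; split=> //.
Qed.

Lemma cexp_continuous : continuous (fun p : R * R =>
  (Re (cexp (p.1 +i* p.2)%C), Im (cexp (p.1 +i* p.2)%C))).
Proof.
rewrite (_ : (fun _ => _) = fun p : R * R =>
  (expR p.1 * cos p.2, expR p.1 * sin p.2)); last first.
  by apply/funext => q; rewrite cexpE.
move=> p.
have p1 : fst @ p --> p.1 by exact: cvg_fst.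
have p2 : snd @ p --> p.2 by exact: cvg_snd.
have ec : (fun p : R * R => expR p.1) @ p --> expR p.1.
  exact: (cvg_comp _ _ p1 (@continuous_expR R p.1)).
have cc := cvg_comp _ _ p2 (@continuous_cos R p.2).
have sc := cvg_comp _ _ p2 (@continuous_sin R p.2).
exact: (cvg_pair (cvgM ec cc) (cvgM ec sc)).
Qed.

Lemma openC_preimage_cexp (D : set C) : openC D -> openC (cexp @^-1` D).
Proof.
move=> oD; rewrite /openC (_ : plane _ = (fun p : R * R =>
  (Re (cexp (p.1 +i* p.2)%C), Im (cexp (p.1 +i* p.2)%C))) @^-1` plane D).
  by apply: open_comp => // p _; exact: cexp_continuous.
by apply/funext => p; exact: (congr1 D (complexE _)).
Qed.

Lemma openC_half_plane : openC (@half_plane R).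
Proof.
rewrite /openC (_ : plane _ = fst @^-1` [set x : R | x < 0]); last first.
  by apply/seteqP; split=> -[].
by apply: open_comp; [move=> p _; exact: cvg_fst|exact: open_lt].
Qed.

End ExponentialAndLogarithm.

Lemma seq_directv_independent (K : fieldType) (vT : vectType K) (I : eqType)
    (r : seq I) (V : I -> {vspace vT}) (u : I -> vT) :
  directv (\sum_(p <- r) V p)%VS -> (forall p, u p \in V p) ->
  \sum_(p <- r) u p = 0 -> forall p, p \in r -> u p = 0.
Proof.
rewrite directvE /= !(big_tnth _ _ r) -directvE /= => dV uV u0 p pr.
have /tnthP[i ->] : p \in in_tuple r by [].
have /directv_sum_independent/(_ (fun i => u (tnth (in_tuple r) i))) := dV.
by apply => //.
Qed.

(** * Linear algebra in the fibres *)

Section HodgeFibres.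
Variables (R : realType) (X : set R[i]) (n : int) (E : pvhs X n).
Local Notation C := R[i].

Definition hodge_bound : nat := (\sum_(p <- hodge_types E) `|p|).+1.

(* The Hodge types lie strictly between [hodge_low] and
   [hodge_low + hodge_len]; below, the index [j] stands for the type
   [hodge_low + j]. *)
Definition hodge_low : int := - hodge_bound%:Z.
Definition hodge_len : nat := (hodge_bound + hodge_bound)%N.

Definition hfib (j : nat) (t : C) : {vspace E t} := hodge E (hodge_low + j%:Z) t.
Definition hcomp (j : nat) (t : C) (v : E t) : E t :=
  hodge_comp (hodge_types E) (@hodge _ _ _ E) (hodge_low + j%:Z) v.
Definition hsgn (j : nat) : C := (-1) ^ (n - (hodge_low + j%:Z)).
Local Notation Q := (@pol _ _ _ E).

Lemma hodge_types_bound p : p \in hodge_types E -> (`|p| < hodge_bound)%N.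
Proof. by move=> pE; rewrite /hodge_bound ltnS (big_rem p)//= leq_addr. Qed.

(** The bounds are strict at both ends: over [X], the index 0 and all indices from [hodge_len] on
    carry the zero space. Hence the shifted sums below have no boundary terms, and inductions on the
    index start from zero components. *)
Lemma hodge_typesP p : p \in hodge_types E ->
  exists2 j : nat, (0 < j < hodge_len)%N & p = hodge_low + j%:Z.
Proof.
move=> /hodge_types_bound pB; exists (absz (p + hodge_bound%:Z)).
  by rewrite /hodge_len; lia.
by rewrite /hodge_low; lia.
Qed.

Lemma sum_hodge_types (V : nmodType) (F : int -> V) :
  (forall p, p \notin hodge_types E -> F p = 0) ->
  \sum_(p <- hodge_types E) F p = \sum_(j < hodge_len) F (hodge_low + j%:Z).
Proof.
move=> F0; have := @hodge_typesP; move: hodge_len => N typesP.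
rewrite -(big_mkord xpredT (fun j => F (hodge_low + j%:Z))).
rewrite -(big_map (fun j : nat => hodge_low + j%:Z) xpredT F).
rewrite [RHS](bigID (mem (hodge_types E)))/= [X in _ + X]big1 ?addr0//.
rewrite -[RHS]big_filter.
apply: perm_big; apply: uniq_perm.
- exact: hodge_types_uniq.
- rewrite filter_uniq// map_inj_uniq ?iota_uniq// => i j /addrI; lia.
move=> p; rewrite mem_filter; case: (boolP (p \in _)) => //= pE.
have [j /andP[_ jN] ->] := typesP _ pE.
by apply/esym/mapP; exists j => //; rewrite mem_index_iota.
Qed.

Lemma hodge_comp_mem p t (v : E t) :
  hodge_comp (hodge_types E) (@hodge _ _ _ E) p v \in hodge E p t.
Proof. exact: memv_sum_pi. Qed.

Lemma hodge_comp_notin p t (v : E t) : X t -> p \notin hodge_types E ->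
  hodge_comp (hodge_types E) (@hodge _ _ _ E) p v = 0.
Proof.
move=> Xt pE; apply/eqP; rewrite -memv0 -(hodge_support Xt pE).
exact: hodge_comp_mem.
Qed.

Lemma hodge_comp_id p q t (v : E t) : X t -> v \in hodge E p t ->
  hodge_comp (hodge_types E) (@hodge _ _ _ E) q v = if q == p then v else 0.
Proof.
move=> Xt vp; pose c q := hodge_comp (hodge_types E) (@hodge _ _ _ E) q v.
rewrite -/(c q).
have [qE|qE] := boolP (q \in hodge_types E); last first.
  rewrite /c hodge_comp_notin//; case: eqP => // qp; apply/esym/eqP.
  by rewrite -memv0 -(hodge_support Xt qE) qp.
have [pE|pE] := boolP (p \in hodge_types E); last first.
  move: vp; rewrite (hodge_support Xt pE) memv0 => /eqP v0.
  by rewrite /c /hodge_comp v0 linear0 if_same.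
(* Two decompositions of [v] are compared, the one into its projections and the trivial one with [v]
   in type [p]; directness of the sum makes them equal term by term. *)
have u0 : \sum_(q <- hodge_types E) (c q - (if q == p then v else 0)) = 0.
  rewrite sumrB sumv_pi_uniq_sum ?filter_uniq ?hodge_types_uniq//; last first.
    by rewrite (hodge_full E Xt) memvf.
  rewrite (bigD1_seq p)//= ?hodge_types_uniq// eqxx big1 ?addr0 ?subrr//.
  by move=> i /negbTE ->.
have uV q' : c q' - (if q' == p then v else 0) \in hodge E q' t.
  rewrite rpredB ?hodge_comp_mem//; case: eqP => [->//|_]; exact: mem0v.
have := seq_directv_independent (hodge_direct E Xt) uV u0 qE.
by move/eqP; rewrite subr_eq0 => /eqP.
Qed.

Lemma hcomp_mem j t (v : E t) : hcomp j v \in hfib j t.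
Proof. exact: hodge_comp_mem. Qed.

Lemma hcomp0 j t : hcomp j (0 : E t) = 0.
Proof. exact: linear0. Qed.

Lemma hcomp_sum j t (I : Type) (r : seq I) (u : I -> E t) :
  hcomp j (\sum_(i <- r) u i) = \sum_(i <- r) hcomp j (u i).
Proof. exact: linear_sum. Qed.

Lemma hcomp_id i j t (v : E t) : X t -> v \in hfib j t ->
  hcomp i v = if i == j then v else 0.
Proof.
move=> Xt vj; rewrite /hcomp (hodge_comp_id _ Xt vj).
by rewrite (inj_eq (addrI _)) eqz_nat.
Qed.

Lemma hodge_low_notin j : (j == 0%N) || (hodge_len <= j)%N ->
  hodge_low + j%:Z \notin hodge_types E.
Proof.
apply: contraL => /hodge_typesP[i iN /addrI [->]].
by move: iN; lia.
Qed.

Lemma hcomp_out j t (v : E t) : X t -> (j == 0%N) || (hodge_len <= j)%N ->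
  hcomp j v = 0.
Proof. by move=> Xt /hodge_low_notin; exact: hodge_comp_notin. Qed.

Lemma hcomp_hfib_out j t (v : E t) : X t -> (j == 0%N) || (hodge_len <= j)%N ->
  v \in hfib j t -> v = 0.
Proof.
by move=> Xt /hodge_low_notin jE; rewrite /hfib (hodge_support Xt jE) memv0 => /eqP.
Qed.

Lemma sum_hcomp t (v : E t) : X t -> \sum_(j < hodge_len) hcomp j v = v.
Proof.
move=> Xt; rewrite -[RHS](@sumv_pi_uniq_sum _ _ _ (hodge_types E) xpredT
  (fun p => hodge E p t) _ erefl) ?filter_uniq ?hodge_types_uniq//; last first.
  by rewrite (hodge_full E Xt) memvf.
rewrite [RHS](sum_hodge_types (F := fun p =>
  hodge_comp (hodge_types E) (@hodge _ _ _ E) p v))//.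
by move=> p pE; exact: hodge_comp_notin.
Qed.

Lemma Q_ortho i j t (v w : E t) : X t -> i != j ->
  v \in hfib i t -> w \in hfib j t -> Q t v w = 0.
Proof.
by move=> Xt ij; apply: pol_ortho => //; rewrite (inj_eq (addrI _)) eqz_nat.
Qed.

Lemma QDl t (u v w : E t) : Q t (u + v) w = Q t u w + Q t v w.
Proof. exact: linearDl. Qed.
Lemma QDr t (u v w : E t) : Q t w (u + v) = Q t w u + Q t w v.
Proof. exact: linearDr. Qed.
Lemma QNl t (u w : E t) : Q t (- u) w = - Q t u w.
Proof. exact: linearNl. Qed.
Lemma QNr t (u w : E t) : Q t w (- u) = - Q t w u.
Proof. exact: linearNr. Qed.
Lemma Q0l t (w : E t) : Q t 0 w = 0.
Proof. exact: linear0l. Qed.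
Lemma Q0r t (w : E t) : Q t w 0 = 0.
Proof. exact: linear0r. Qed.
Lemma QZl t a (u w : E t) : Q t (a *: u) w = a * Q t u w.
Proof. exact: linearZl_LR. Qed.
Lemma QZr t a (u w : E t) : Q t w (a *: u) = conjc a * Q t w u.
Proof. exact: linearZr_LR. Qed.
Lemma Q_conj t (u w : E t) : Q t u w = conjc (Q t w u).
Proof. by rewrite [LHS]hermC expr0 mul1r. Qed.
Lemma Q_suml t (I : Type) (r : seq I) (u : I -> E t) w :
  Q t (\sum_(i <- r) u i) w = \sum_(i <- r) Q t (u i) w.
Proof. exact: linear_sumlz. Qed.
Lemma Q_sumr t (I : Type) (r : seq I) (u : I -> E t) w :
  Q t w (\sum_(i <- r) u i) = \sum_(i <- r) Q t w (u i).
Proof. exact: linear_sumr. Qed.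

Lemma hsgnS j : hsgn j.+1 = - hsgn j.
Proof.
rewrite /hsgn (_ : n - (hodge_low + j%:Z) = 1 + (n - (hodge_low + j.+1%:Z))); last by lia.
by rewrite [in RHS]expfzDr ?oppr_eq0 ?oner_eq0// [in RHS]expr1z mulN1r opprK.
Qed.

Lemma hsgn_conj j : conjc (hsgn j) = hsgn j.
Proof.
by rewrite /hsgn fmorphXz rmorphN1.
Qed.

Definition hnorm (t : C) (v w : E t) : C :=
  hodge_metric n (hodge_types E) (@hodge _ _ _ E) (@pol _ _ _ E) v w.

Lemma hnormE t (v w : E t) : X t ->
  hnorm v w = \sum_(j < hodge_len) hsgn j * Q t (hcomp j v) (hcomp j w).
Proof.
move=> Xt; rewrite /hnorm /hodge_metric
  (sum_hodge_types (F := fun p => (-1) ^ (n - p) * Q t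
   (hodge_comp (hodge_types E) (@hodge _ _ _ E) p v)
   (hodge_comp (hodge_types E) (@hodge _ _ _ E) p w)))//.
by move=> p pE; rewrite !hodge_comp_notin// Q0l mulr0.
Qed.

Lemma hnorm_gt0 t (v : E t) : X t -> v != 0 -> 0 < hnorm v v.
Proof. exact: metric_pos. Qed.

Lemma hnorm_ge0 t (v : E t) : X t -> 0 <= hnorm v v.
Proof.
move=> Xt; have [->|v0] := eqVneq v 0; last exact/ltW/hnorm_gt0.
by rewrite hnormE// big1// => i _; rewrite hcomp0 Q0l mulr0.
Qed.

Lemma hnorm_hfib j t (v : E t) : X t -> v \in hfib j t ->
  hnorm v v = hsgn j * Q t v v.
Proof.
move=> Xt vj; have [jo|] := boolP ((j == 0%N) || (hodge_len <= j)%N).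
  rewrite (hcomp_hfib_out Xt jo vj) Q0l mulr0 hnormE// big1// => i _.
  by rewrite hcomp0 Q0l mulr0.
rewrite negb_or -ltnNge => /andP[_ jN].
rewrite hnormE// (bigD1 (Ordinal jN))//= (hcomp_id _ Xt vj) eqxx big1 ?addr0//.
move=> i ij; rewrite (hcomp_id _ Xt vj) ifN ?Q0l ?mulr0//.
Qed.

Lemma hsgn_Q_ge0 j t (v : E t) : X t -> v \in hfib j t -> 0 <= hsgn j * Q t v v.
Proof. by move=> Xt vj; rewrite -(hnorm_hfib Xt vj); exact: hnorm_ge0. Qed.

Lemma Q_eq0 j t (v : E t) : X t -> v \in hfib j t -> Q t v v = 0 -> v = 0.
Proof.
move=> Xt vj v0; apply/eqP/negPn/negP => /(hnorm_gt0 Xt).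
by rewrite (hnorm_hfib Xt vj) v0 mulr0 ltxx.
Qed.

End HodgeFibres.

Section ComplexConjugation.
Variable R : realType.

Lemma conjc_real_complex (x : R) : conjc x%:C%C = x%:C%C.
Proof. by apply/eqP; rewrite eq_complex /= oppr0 !eqxx. Qed.

Lemma conjcM (x y : R[i]) : conjc (x * y) = conjc x * conjc y.
Proof. exact: rmorphM. Qed.

Lemma conjcN (x : R[i]) : conjc (- x) = - conjc x.
Proof. exact: rmorphN. Qed.

Lemma conjc_sum (I : Type) (r : seq I) (F : I -> R[i]) :
  conjc (\sum_(i <- r) F i) = \sum_(i <- r) conjc (F i).
Proof. exact: rmorph_sum. Qed.

Lemma complex_ge0E (x : R[i]) : 0 <= x -> exists r : R, x = r%:C%C.
Proof. by case: x => a b; rewrite lecE /= => /andP[/eqP-> _]; exists a. Qed.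

End ComplexConjugation.

(** * The pointwise estimate with gain *)

Section QuadraticEstimate.
Variables (R : realType) (X : set R[i]) (n : int) (E : pvhs X n).
Local Notation C := R[i].
Local Notation Q := (@pol _ _ _ E).
Local Notation N := (hodge_len E).

(** With the weights below, [al j ^+ 2 + be j ^+ 2] equals 1/2 - eps + eps^2 (j^2 + (j + 1)^2). For
    j < N the last term is at most 2 eps^2 N^2, and this is eps / 2 exactly for the present value of
    eps. *)
Definition hodge_eps : R := (4 * N%:R ^+ 2)^-1.
(** Since [al j.+1 + be j = 1], these weights average the two expressions of A term by term. At
    equal indices, however, [al j + be j = 1 - hodge_eps]: this drift improves on the constant
    weights 1/2, which give the estimate without gain. *)
Let al (j : nat) : R := 2^-1 + hodge_eps * j%:R.
Let be (j : nat) : R := 2^-1 - hodge_eps * j.+1%:R.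

Lemma hodge_len_gt0 : 0 < (N%:R : R).
Proof. by rewrite ltr0n /hodge_len. Qed.

Lemma hodge_eps_gt0 : 0 < hodge_eps.
Proof. by rewrite invr_gt0 mulr_gt0// exprn_gt0// hodge_len_gt0. Qed.

Lemma hodge_eps_lt1 : hodge_eps < 1.
Proof.
rewrite invf_lt1 ?mulr_gt0 ?exprn_gt0 ?hodge_len_gt0//.
have : 1 <= (N%:R : R) by rewrite ler1n /hodge_len.
by move=> N1; rewrite (@lt_le_trans _ _ (4 * 1))//; [lra|rewrite ler_pM2l// exprn_ege1].
Qed.

Lemma hodge_weights j : (j < N)%N -> al j ^+ 2 + be j ^+ 2 <= (1 - hodge_eps) / 2.
Proof.
move=> jN; rewrite /al /be -(@natr1 _ j).
have j1 : (j%:R : R) + 1 <= N%:R by rewrite natr1 ler_nat.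
have j0 : 0 <= (j%:R : R) by [].
have e0 := hodge_eps_gt0.
have eN : hodge_eps * (4 * N%:R ^+ 2) = 1.
  by rewrite mulVf// mulf_neq0// expf_neq0// lt0r_neq0// hodge_len_gt0.
move: (j%:R) (N%:R) (hodge_eps) j1 j0 e0 eN => x y e x1 x0 e0 ey.
have ee : e * e * (4 * y ^+ 2) = e by rewrite -mulrA ey mulr1.
have xy : x ^+ 2 + (x + 1) ^+ 2 <= 2 * y ^+ 2 by nra.
have : e * e * (x ^+ 2 + (x + 1) ^+ 2) <= e * e * (2 * y ^+ 2).
  by rewrite ler_pM2l// mulr_gt0.
have -> : e * e * (2 * y ^+ 2) = e / 2 by rewrite -[in RHS]ee; field.
have -> : (2^-1 + e * x) ^+ 2 + (2^-1 - e * (x + 1)) ^+ 2 =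
  2^-1 - e + e * e * (x ^+ 2 + (x + 1) ^+ 2) by field.
lra.
Qed.

Lemma hsgn_Q_sub t j (w v : E t) (x : C) :
  hsgn E j * Q t (w - x *: v) (w - x *: v) =
  hsgn E j * Q t w w - (conjc x * (hsgn E j * Q t w v) + x * (hsgn E j * Q t v w))
  + x * conjc x * (hsgn E j * Q t v v).
Proof.
by rewrite QDl !QDr !QNl !QNr !QZl !QZr; ring.
Qed.

Lemma shift_sum (g : nat -> C) m : 0 <= g 0%N -> g m = 0 ->
  \sum_(j < m) g j.+1 <= \sum_(j < m) g j.
Proof.
move=> g0 gm; have : \sum_(j < m.+1) g j = \sum_(j < m) g j by rewrite big_ord_recr /= gm addr0.
by rewrite big_ord_recl /= => <-; rewrite lerDr.
Qed.

(** A weighted Cauchy-Schwarz inequality. The last hypothesis on [Q] gives each term of [A] two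
    forms, so that it can be charged partly to [w j.+1] and partly to [y j]. The weights that meet
    at one [v j] yield |A|^2 <= (1 - eps) / 2 f S, and (1 - eps) (1 + eps) <= 1. *)
Lemma hodge_quadratic_estimate t (v w y : nat -> E t) : X t ->
  (forall j, v j \in hfib E j t) -> (forall j, w j \in hfib E j t) ->
  (forall j, y j \in hfib E j t) ->
  (forall j, Q t (v j.+1) (w j.+1) = Q t (y j) (v j)) ->
  let f := \sum_(j < N) hsgn E j * Q t (v j) (v j) in
  let A := \sum_(j < N) hsgn E j.+1 * Q t (v j.+1) (w j.+1) in
  let S := \sum_(j < N) (hsgn E j.+1 * Q t (w j.+1) (w j.+1) + hsgn E j * Q t (y j) (y j)) in
  0 < f -> (2 * (1 + hodge_eps))%:C%C * (A * conjc A) <= f * S.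
Proof.
move=> Xt vF wF yF vwy f A S f0.
have q0 j u : u \in hfib E j t -> 0 <= hsgn E j * Q t u u by exact: hsgn_Q_ge0.
pose B := \sum_(j < N) ((al j.+1 ^+ 2)%:C%C * (hsgn E j.+1 * Q t (v j.+1) (v j.+1))
   + (be j ^+ 2)%:C%C * (hsgn E j * Q t (v j) (v j))).
have S_ge0 : 0 <= S.
  by apply: sumr_ge0 => j _; rewrite addr_ge0// q0.
have D_ge0 : 0 <= A * conjc A by rewrite -sqr_normc exprn_ge0.
have vN : v N = 0 by apply: (hcomp_hfib_out Xt _ (vF N)); rewrite leqnn orbT.
have BB' : B <= ((1 - hodge_eps) / 2)%:C%C * f.
  (* The terms in [al j.+1] are shifted to index [j]: the term at [N] vanishes and the added term at
     0 is nonnegative. *)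
  rewrite /B big_split /= (@le_trans _ _ (\sum_(j < N) ((al j ^+ 2)%:C%C * (hsgn E j * Q t (v j) (v j)))
     + \sum_(j < N) ((be j ^+ 2)%:C%C * (hsgn E j * Q t (v j) (v j)))))//.
    rewrite lerD2r; apply: (@shift_sum (fun j => (al j ^+ 2)%:C%C * (hsgn E j * Q t (v j) (v j)))).
      by rewrite mulr_ge0 ?q0// (_ : 0 = 0%:C%C)// lecR sqr_ge0.
    by rewrite vN Q0l !mulr0.
  rewrite -big_split /= mulr_sumr; apply: ler_sum => j _.
  by rewrite -mulrDl ler_wpM2r ?q0// -rmorphD /= lecR hodge_weights.
(* The right-hand side is the sum of the squared norms of w - c al v and
   y + conj c be v, with al + be = 1. *)
have main c : 0 <= S - (c * A + conjc (c * A)) + c * conjc c * B.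
  have -> : S - (c * A + conjc (c * A)) + c * conjc c * B =
    \sum_(j < N) (hsgn E j.+1 * Q t (w j.+1 - (c * (al j.+1)%:C%C) *: v j.+1)
         (w j.+1 - (c * (al j.+1)%:C%C) *: v j.+1) +
      hsgn E j * Q t (y j - (- (conjc c * (be j)%:C%C)) *: v j)
         (y j - (- (conjc c * (be j)%:C%C)) *: v j)).
    rewrite /S /A /B conjcM conjc_sum !mulr_sumr -big_split /= -sumrB -big_split /=.
    apply: eq_bigr => j _; rewrite !hsgn_Q_sub -(vwy j).
    rewrite -[Q t (v j) (y j)]conjcK -Q_conj -(vwy j).
    rewrite [Q t (w _) (v _)]Q_conj hsgnS.
    rewrite !(conjcM, conjcN, conjcK, conjc_real_complex) hsgn_conj.
    rewrite !rmorphXn /=.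
    have -> : (al j.+1)%:C%C = 1 - (be j)%:C%C.
      by rewrite -[1]/(1%:C%C) -rmorphB /=; congr (_%:C%C); rewrite /al /be; lra.
    ring.
  by apply: sumr_ge0 => j _; rewrite addr_ge0// q0// rpredB// rpredZ.
have [fr fE] := complex_ge0E (ltW f0).
have [Sr SE] := complex_ge0E S_ge0.
have [d dE] := complex_ge0E D_ge0.
have B_ge0 : 0 <= B.
  apply: sumr_ge0 => j _; apply: addr_ge0; apply: mulr_ge0; rewrite ?q0//;
  by rewrite (_ : 0 = 0%:C%C)// lecR sqr_ge0.
have [Br BE] := complex_ge0E B_ge0.
have e0 := hodge_eps_gt0; have e1 := hodge_eps_lt1.
move: f0 BB'; rewrite fE BE -rmorphM /= lecR (_ : 0 = 0%:C%C)// ltcR => f0 BB'.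
(* The upper bound of [B] replaces [B] as a divisor: it is positive because f is, whereas [B] itself
   is only known to be nonnegative. *)
pose b := (1 - hodge_eps) / 2 * fr.
have b0 : 0 < b by rewrite mulr_gt0// divr_gt0// subr_gt0.
(* This [c] minimizes S - 2 Re (c A) + |c|^2 b. *)
have := main (conjc A * (b^-1)%:C%C).
have -> : conjc A * (b^-1)%:C%C * A = d%:C%C * (b^-1)%:C%C by rewrite -dE; ring.
have -> : conjc A * (b^-1)%:C%C * conjc (conjc A * (b^-1)%:C%C) =
    d%:C%C * (b^-1)%:C%C * (b^-1)%:C%C.
  by rewrite conjcM conjcK conjc_real_complex -dE; ring.
rewrite SE BE -!rmorphM conjc_real_complex -rmorphD -rmorphB -rmorphD /=.
rewrite (_ : 0 = 0%:C%C)// lecR => mainR.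
rewrite dE -!rmorphM /= lecR.
have d0 : 0 <= d by move: D_ge0; rewrite dE (_ : 0 = 0%:C%C)// lecR.
have S0 : 0 <= Sr by move: S_ge0; rewrite SE (_ : 0 = 0%:C%C)// lecR.
have dS : d <= Sr * b.
  rewrite -ler_pdivrMr//.
  have : d / b / b * Br <= d / b / b * b.
    by rewrite ler_wpM2l// !divr_ge0// ltW.
  by rewrite divfK ?lt0r_neq0//; lra.
apply: (@le_trans _ _ (2 * (1 + hodge_eps) * (Sr * b))).
  by rewrite ler_wpM2l// mulr_ge0// addr_ge0// ltW.
have -> : 2 * (1 + hodge_eps) * (Sr * b) = (1 - hodge_eps ^+ 2) * (fr * Sr).
  by rewrite /b; field.
apply: ler_piMl; first by rewrite mulr_ge0// ltW.
by rewrite lerBlDr lerDl sqr_ge0.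
Qed.

End QuadraticEstimate.

(** * Derivatives of the Hodge norm of a flat section *)

Section SmoothSections.
Variables (R : realType) (X : set R[i]) (E : bundle X).
Local Notation C := R[i].
Implicit Types (U V : set C) (s : section E).

Lemma smooth_section_eq U s s' : openC U -> (forall t, U t -> s t = s' t) ->
  smooth_section U s -> smooth_section U s'.
Proof.
move=> oU ss' sU i k; have oD := openCI oU (@dom_open _ _ E i).
by apply: (smooth_eq oD _ (sU i k)) => t [Ut _]; rewrite ss'.
Qed.

Lemma smooth_section_sub U V s : V `<=` U -> smooth_section U s -> smooth_section V s.
Proof. by move=> VU sU i k; apply: smooth_sub (sU i k) => t [/VU]. Qed.

Lemma smooth_section_local U s :
  (forall t, U t -> exists2 V, V t & smooth_section V s) -> smooth_section U s.
Proof.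
move=> loc i k; apply: smooth_local => t [Ut it]; have [V Vt sV] := loc t Ut.
by exists (V `&` dom i).
Qed.

Lemma smooth_section0 U : openC U -> smooth_section U (fun t => 0 : E t).
Proof.
move=> oU i k; have oD := openCI oU (@dom_open _ _ E i).
by apply: (smooth_eq oD _ (smooth_cst 0 oD)) => t _; rewrite linear0 mxE.
Qed.

Lemma smooth_sectionD U s s' : openC U -> smooth_section U s ->
  smooth_section U s' -> smooth_section U (fun t => s t + s' t).
Proof.
move=> oU sU s'U i k; have oD := openCI oU (@dom_open _ _ E i).
by apply: (smooth_eq oD _ (smoothD oD (sU i k) (s'U i k))) => t _; rewrite linearD mxE.
Qed.

Lemma smooth_sectionZ U f s : openC U -> smooth_on U f -> smooth_section U s ->
  smooth_section U (fun t => f t *: s t).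
Proof.
move=> oU fU sU i k; have oD := openCI oU (@dom_open _ _ E i).
have fD : smooth_on (U `&` dom i) f by apply: smooth_sub fU => t [].
by apply: (smooth_eq oD _ (smoothM oD fD (sU i k))) => t _; rewrite linearZ mxE.
Qed.

Lemma smooth_section_sum (I : Type) (r : seq I) U (S : I -> section E) :
  openC U -> (forall i, smooth_section U (S i)) ->
  smooth_section U (fun t => \sum_(i <- r) S i t).
Proof.
move=> oU SU; elim: r => [|i r IH].
  by apply: (smooth_section_eq oU _ (smooth_section0 oU)) => t _; rewrite big_nil.
by apply: (smooth_section_eq oU _ (smooth_sectionD oU (SU i) IH)) => t _; rewrite big_cons.
Qed.

Variable d : connection E.

Lemma d_zero U t : openC U -> U `<=` X -> U t ->
  d10 d (fun t => 0 : E t) t = 0 /\ d01 d (fun t => 0 : E t) t = 0.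
Proof.
move=> oU UX Ut; have s0 := smooth_section0 oU.
have [] := d_additive d oU UX s0 s0 Ut.
rewrite (_ : (fun x => 0 + 0 : E x) = (fun x => 0)); last first.
  by apply/functional_extensionality_dep => x; rewrite addr0.
move=> /eqP; rewrite -[X in X == _]addr0 (inj_eq (addrI _)) => /eqP <-.
by move=> /eqP; rewrite -[X in X == _]addr0 (inj_eq (addrI _)) => /eqP <-.
Qed.

Lemma d_scale U (c : C) s t : openC U -> U `<=` X -> smooth_section U s -> U t ->
  d10 d (fun t => c *: s t) t = c *: d10 d s t /\
  d01 d (fun t => c *: s t) t = c *: d01 d s t.
Proof.
move=> oU UX sU Ut.
have [-> ->] := d_leibniz d oU UX (smooth_cst c oU) sU Ut.
by rewrite dz_cst dzbar_cst !scale0r !add0r.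
Qed.

Lemma d_sum (I : Type) (r : seq I) U (S : I -> section E) t :
  openC U -> U `<=` X -> (forall i, smooth_section U (S i)) -> U t ->
  d10 d (fun t => \sum_(i <- r) S i t) t = \sum_(i <- r) d10 d (S i) t /\
  d01 d (fun t => \sum_(i <- r) S i t) t = \sum_(i <- r) d01 d (S i) t.
Proof.
move=> oU UX SU Ut; elim: r => [|i r IH].
  rewrite !big_nil (_ : (fun t => _) = (fun t => 0)); first exact: (d_zero oU UX Ut).
  by apply/functional_extensionality_dep => x; rewrite big_nil.
have rU := smooth_section_sum r oU SU.
rewrite !big_cons (_ : (fun t => _) = (fun t => S i t + \sum_(i <- r) S i t)); last first.
  by apply/functional_extensionality_dep => x; rewrite big_cons.
have [-> ->] := d_additive d oU UX (SU i) rU Ut.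
by rewrite IH.1 IH.2.
Qed.

Lemma d_sub U s s' t : openC U -> U `<=` X -> smooth_section U s ->
  smooth_section U s' -> U t ->
  d10 d (fun t => s t - s' t) t = d10 d s t - d10 d s' t /\
  d01 d (fun t => s t - s' t) t = d01 d s t - d01 d s' t.
Proof.
move=> oU UX sU s'U Ut.
rewrite (_ : (fun t => _) = (fun t => s t + (-1) *: s' t)); last first.
  by apply/functional_extensionality_dep => x; rewrite scaleN1r.
have [-> ->] := d_additive d oU UX sU (smooth_sectionZ oU (smooth_cst (-1) oU) s'U) Ut.
by have [-> ->] := d_scale (-1) oU UX s'U Ut; rewrite !scaleN1r.
Qed.

End SmoothSections.

(** * Smoothness of the Hodge components *)

Section HodgeProjection.
Variables (R : realType) (X : set R[i]) (n : int) (E : pvhs X n).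
Local Notation C := R[i].
Local Notation Q := (@pol _ _ _ E).

(* Q is definite on each E^p, so the components in a local frame of E^p are
   smooth functions of the Gram matrix. *)
Lemma gram_unit j t m (e : m.-tuple (E t)) : X t -> basis_of (hfib E j t) e ->
  (\matrix_(k, l) (Q t (tnth e k) (tnth e l)) : 'M[C]_m) \in unitmx.
Proof.
move=> Xt eb; rewrite -row_free_unit; apply: inj_row_free => x xG.
pose u := \sum_(k < m) x 0 k *: (tnth e k).
have uF : u \in hfib E j t.
  apply: rpred_sum => k _; apply: rpredZ; apply: (basis_mem eb).
  exact: mem_tnth.
have u0 : u = 0.
  apply: (Q_eq0 Xt uF); rewrite {2}/u Q_sumr big1// => l _.
  rewrite QZr /u Q_suml; have /rowP/(_ l) := xG; rewrite !mxE => xGl.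
  rewrite (_ : \sum_k _ = 0) ?mulr0// -[RHS]xGl; apply: eq_bigr => k _.
  by rewrite QZl mxE.
apply/rowP => k; rewrite mxE.
have /freeP := basis_free eb; apply; rewrite -[RHS]u0.
by apply: eq_bigr => l _; rewrite -tnth_nth.
Qed.

(** By orthogonality, [Q t v] against a vector of E^j sees only the E^j-component of [v]. The
    coordinates of that component therefore solve a linear system whose matrix is the Gram
    matrix. *)
Lemma hcomp_gram j t m (e : m.-tuple (E t)) (v : E t) : X t ->
  basis_of (hfib E j t) e ->
  hcomp j v = \sum_(k < m) ((\row_l (Q t v (tnth e l))) *m
    invmx (\matrix_(k, l) (Q t (tnth e k) (tnth e l)))) 0 k *: (tnth e k).
Proof.
move=> Xt eb; have eF k : tnth e k \in hfib E j t by apply: (basis_mem eb); exact: mem_tnth.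
pose c : 'rV[C]_m := \row_k coord e k (hcomp j v).
have vE : hcomp j v = \sum_(k < m) c 0 k *: (tnth e k).
  rewrite {1}(coord_basis eb (hcomp_mem j v)); apply: eq_bigr => k _.
  by rewrite mxE (tnth_nth 0).
rewrite (_ : _ *m _ = c); first exact: vE.
rewrite -[RHS](mulmxK (gram_unit Xt eb)); congr (_ *m _).
apply/rowP => l; rewrite !mxE.
have -> : Q t v (tnth e l) = Q t (hcomp j v) (tnth e l).
  rewrite -{1}(sum_hcomp v Xt) Q_suml.
  have [jN|jN] := ltnP j (hodge_len E).
    rewrite (bigD1 (Ordinal jN))//= big1 ?addr0// => i ij.
    exact: (Q_ortho Xt _ (hcomp_mem _ _) (eF l)).
  rewrite (hcomp_out _ Xt) ?jN ?orbT// Q0l big1// => i _.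
  apply: (Q_ortho Xt _ (hcomp_mem _ _) (eF l)).
  by rewrite ltn_eqF// (leq_trans (ltn_ord i)).
rewrite vE Q_suml; apply: eq_bigr => k _; by rewrite QZl !mxE.
Qed.

(** A variation of Hodge structure provides smooth local frames of each E^p, not smooth projections.
    The coefficients in such a frame are smooth because they are built from pairings of smooth
    sections and an inverse Gram matrix. *)
Lemma smooth_hcomp j U (s : section E) : openC U -> U `<=` X ->
  smooth_section U s -> smooth_section U (fun t => hcomp j (s t)).
Proof.
move=> oU UX sU; apply: smooth_section_local => t Ut.
have [V [m [e [oV Vt VX eV eb]]]] := hodge_smooth E (hodge_low E + j%:Z) (UX _ Ut).
exists (U `&` V) => //.
have oW := openCI oU oV; have WX : U `&` V `<=` X by move=> x [/UX].
have sW := smooth_section_sub (@subIsetl _ U V) sU.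
have eW k := smooth_section_sub (@subIsetr _ U V) (eV k).
have eE t' (k : 'I_m) : tnth [tuple e k t' | k < m] k = e k t' by rewrite tnth_mktuple.
pose c k x := ((\row_l (Q x (s x) (e l x))) *m invmx (\matrix_(k, l) (Q x (e k x) (e l x)))) 0 k.
have E1 x : (U `&` V) x -> hcomp j (s x) = \sum_(k < m) c k x *: e k x.
  move=> Wx; rewrite (hcomp_gram (s x) (WX _ Wx) (eb x Wx.2)).
  apply: eq_bigr => k _; rewrite eE; congr (_ *: _); rewrite /c; congr ((_ *m invmx _) _ _).
    by apply/rowP => l; rewrite !mxE eE.
  by apply/matrixP => l l'; rewrite !mxE !eE.
apply: (smooth_section_eq oW (fun x Wx => esym (E1 x Wx))).
apply: smooth_section_sum => // k; apply: smooth_sectionZ => //.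
have gramW k1 k2 : smooth_on (U `&` V) (fun x => Q x (e k1 x) (e k2 x)).
  exact: (pol_smooth oW WX (eW k1) (eW k2)).
rewrite /c; apply: (@smooth_eq _ _ (fun x => \sum_l Q x (s x) (e l x) *
  invmx (\matrix_(k, l) (Q x (e k x) (e l x))) l k)) => //.
  by move=> x _; rewrite mxE; apply: eq_bigr => l _; rewrite mxE.
apply: smooth_sum => // l _; apply: smoothM => //.
  exact: (pol_smooth oW WX sW (eW l)).
apply: smooth_invmx => // [k1 k2|x Wx].
  by apply: (smooth_eq oW _ (gramW k1 k2)) => x _; rewrite mxE.
have := gram_unit (WX _ Wx) (eb x Wx.2).
congr (_ \in unitmx); apply/matrixP => k1 k2; by rewrite !mxE !eE.
Qed.

End HodgeProjection.

Local Arguments hodge_len : simpl never.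

(** * First and second derivatives of the Hodge norm of a flat section *)

Section FlatSection.
Variables (R : realType) (X : set R[i]) (n : int) (E : pvhs X n).
Local Notation C := R[i].
Local Notation Q := (@pol _ _ _ E).
Local Notation D := (conn E).
Local Notation N := (hodge_len E).

Lemma hodge_comp_addv p q r t (v : E t) : X t -> p != q ->
  v \in (hodge E p t + hodge E q t)%VS -> r != p -> r != q ->
  hodge_comp (hodge_types E) (@hodge _ _ _ E) r v = 0.
Proof.
move=> Xt pq /memv_addP[a ap [b bq ->]] rp rq.
have -> : hodge_comp (hodge_types E) (@hodge _ _ _ E) r (a + b) =
  hodge_comp (hodge_types E) (@hodge _ _ _ E) r a +
  hodge_comp (hodge_types E) (@hodge _ _ _ E) r b by exact: linearD.
by rewrite (hodge_comp_id _ Xt ap) (hodge_comp_id _ Xt bq) (negbTE rp) (negbTE rq) addr0.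
Qed.

Variables (U : set C) (oU : openC U) (UX : U `<=` X).

Section TypeShift.
Variables (j : nat) (s : section E).
Hypotheses (sU : smooth_section U s) (sF : forall t, U t -> s t \in hfib E j t).

Lemma hcomp_d01 i t : U t -> i != j -> i != j.+1 -> hcomp i (d01 D s t) = 0.
Proof.
move=> Ut ij ijS; have [_ H] := conn_hodge oU UX sU sF Ut.
apply: (hodge_comp_addv (UX Ut) _ H); lia.
Qed.

Lemma hcomp_d10 i t : U t -> i != j -> i.+1 != j -> hcomp i (d10 D s t) = 0.
Proof.
move=> Ut ij ijS; have [H _] := conn_hodge oU UX sU sF Ut.
apply: (hodge_comp_addv (UX Ut) _ H); lia.
Qed.

End TypeShift.

Variable s : section E.
Hypothesis sU : smooth_section U s.
Hypothesis s_flat : forall t, U t -> d10 D s t = 0 /\ d01 D s t = 0.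

Definition vproj j : section E := fun t => hcomp j (s t).
(* In the notation of the header, [wproj j] is W_j and [yproj j] is X_(j+1), the
   negative of the E^j-part of the dt-component of d v_j (the two agree as d v = 0). *)
Definition wproj j : section E := fun t => hcomp j (d01 D (vproj j) t).
Definition yproj j : section E := fun t => - hcomp j (d10 D (vproj j) t).

Let vU j : smooth_section U (vproj j).
Proof. exact: smooth_hcomp. Qed.
Let vF j t : vproj j t \in hfib E j t.
Proof. exact: hcomp_mem. Qed.
Let wF j t : wproj j t \in hfib E j t.
Proof. exact: hcomp_mem. Qed.
Let yF j t : yproj j t \in hfib E j t.
Proof. by rewrite memvN; exact: hcomp_mem. Qed.
Let wU j : smooth_section U (wproj j).
Proof. by apply: smooth_hcomp => //; have [] := d_smooth D oU UX (vU j). Qed.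
Let yU j : smooth_section U (yproj j).
Proof.
have [H _] := d_smooth D oU UX (vU j).
apply: (smooth_section_eq oU _ (smooth_sectionZ oU (smooth_cst (-1) oU)
  (smooth_hcomp j oU UX H))) => t _.
by rewrite scaleN1r.
Qed.

Let sumv t : U t -> \sum_(j < N) vproj j t = s t.
Proof. by move=> Ut; exact: (sum_hcomp _ (UX Ut)). Qed.

Lemma sum_d_vproj t : U t ->
  \sum_(j < N) d10 D (vproj j) t = 0 /\ \sum_(j < N) d01 D (vproj j) t = 0.
Proof.
move=> Ut.
have [<- <-] := d_sum D (index_enum 'I_N) oU UX (fun j : 'I_N => vU j) Ut.
have SU := smooth_section_sum (index_enum 'I_N) oU (fun j : 'I_N => vU j).
have [-> ->] := d_local D oU UX SU (fun t Ut => sumv Ut) Ut.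
exact: s_flat.
Qed.

(** Only [vproj j] and [vproj j.+1] contribute type [j.+1] to the dtbar-part of d s; as d s = 0, the
    two contributions cancel. *)
Lemma hcomp_d01_cancel j t : U t ->
  hcomp j.+1 (d01 D (vproj j) t) = - wproj j.+1 t.
Proof.
move=> Ut; have Xt := UX Ut; have [jN|jN] := ltnP j.+1 N; last first.
  by rewrite /wproj !(hcomp_out _ Xt) ?jN ?orbT// oppr0.
have [_ /(congr1 (@hcomp _ _ _ E j.+1 t))] := sum_d_vproj Ut.
rewrite hcomp0 hcomp_sum (bigD1 (Ordinal jN))//= (bigD1 (Ordinal (ltnW jN)))/=; last first.
  by rewrite -val_eqE /= ltn_eqF.
rewrite big1 ?addr0 => [/eqP|i /andP[i1 i2]].
  by rewrite addr_eq0 => /eqP; rewrite /wproj => ->; rewrite opprK.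
apply: (hcomp_d01 (vU i)) => //.
  by move: i1; rewrite -val_eqE /= eq_sym.
by move: i2; rewrite -val_eqE /= eqSS eq_sym.
Qed.

Lemma hcomp_d10_cancel j t : U t ->
  hcomp j (d10 D (vproj j.+1) t) = yproj j t.
Proof.
move=> Ut; have Xt := UX Ut; have [jN|jN] := ltnP j N; last first.
  by rewrite /yproj !(hcomp_out _ Xt) ?jN ?orbT// oppr0.
have vz (i : nat) x : U x -> (N <= i)%N -> vproj i x = 0.
  by move=> Ux iN; rewrite /vproj (hcomp_out _ (UX Ux)) ?iN ?orbT.
have [/(congr1 (@hcomp _ _ _ E j t)) + _] := sum_d_vproj Ut.
have {}jN : (j.+1 < N.+1)%N by [].
(* [j.+1] may equal [N]; the vanishing term at [N] is added so that it becomes an index of the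
   sum. *)
have -> : \sum_(i < N) d10 D (vproj i) t = \sum_(i < N.+1) d10 D (vproj i) t.
  rewrite [RHS]big_ord_recr /= (_ : d10 D (vproj N) t = 0) ?addr0//.
  have [-> _] := d_local D oU UX (vU N) (fun x Ux => vz N x Ux (leqnn N)) Ut.
  by have [] := d_zero D oU UX Ut.
rewrite hcomp0 hcomp_sum (bigD1 (Ordinal jN))//= (bigD1 (Ordinal (ltnW jN)))/=; last first.
  by rewrite -val_eqE /= ltn_eqF.
rewrite big1 ?addr0 => [/eqP|i /andP[i1 i2]].
  by rewrite addr_eq0 => /eqP; rewrite /yproj.
apply: (hcomp_d10 (vU i)) => //.
  by move: i2; rewrite -val_eqE /= eq_sym.
by move: i1; rewrite -val_eqE /= eq_sym.
Qed.

Lemma d01_vproj j t : U t -> d01 D (vproj j) t = wproj j t - wproj j.+1 t.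
Proof.
move=> Ut; have Xt := UX Ut.
rewrite -[LHS](sum_hcomp _ Xt) -hcomp_d01_cancel //.
have [jN|jN] := ltnP j N; last first.
  rewrite big1 => [|i _]; first by rewrite /wproj !(hcomp_out _ Xt) ?addr0// ?jN ?orbT// leqW ?orbT.
  by apply: (hcomp_d01 (vU j)) => //; have := ltn_ord i; lia.
rewrite (bigD1 (Ordinal jN))//=; congr (_ + _).
have [jSN|jSN] := ltnP j.+1 N; last first.
  rewrite (hcomp_out _ Xt) ?jSN ?orbT// big1// => i; rewrite -val_eqE /= => ij.
  by apply: (hcomp_d01 (vU j)) => //; have := ltn_ord i; lia.
rewrite (bigD1 (Ordinal jSN))/=; last by rewrite -val_eqE /= gtn_eqF.
rewrite big1 ?addr0// => i /andP[]; rewrite -!val_eqE /= => i1 i2.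
exact: (hcomp_d01 (vU j)).
Qed.

Lemma d10_vproj j t : U t -> d10 D (vproj j.+1) t = yproj j t - yproj j.+1 t.
Proof.
move=> Ut; have Xt := UX Ut.
rewrite -[LHS](sum_hcomp _ Xt) -hcomp_d10_cancel // /yproj opprK.
have [jN|jN] := ltnP j N; last first.
  rewrite big1 => [|i _]; first by rewrite !(hcomp_out _ Xt) ?addr0// ?jN ?orbT// leqW ?orbT.
  by apply: (hcomp_d10 (vU j.+1)) => //; have := ltn_ord i; lia.
rewrite (bigD1 (Ordinal jN))//=; congr (_ + _).
have [jSN|jSN] := ltnP j.+1 N; last first.
  rewrite (hcomp_out _ Xt) ?jSN ?orbT// big1// => i; rewrite -val_eqE /= => ij.
  by apply: (hcomp_d10 (vU j.+1)) => //; have := ltn_ord i; lia.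
rewrite (bigD1 (Ordinal jSN))/=; last by rewrite -val_eqE /= gtn_eqF.
rewrite big1 ?addr0// => i /andP[]; rewrite -!val_eqE /= => i1 i2.
exact: (hcomp_d10 (vU j.+1)).
Qed.

Lemma d_zero_on (u : section E) t : (forall x, U x -> u x = 0) -> U t ->
  d10 D u t = 0 /\ d01 D u t = 0.
Proof.
move=> u0 Ut.
have [<- <-] := d_local D oU UX (@smooth_section0 _ _ E _ oU) (fun x Ux => esym (u0 x Ux)) Ut.
exact: (d_zero D oU UX Ut).
Qed.

Let out0 (u : forall j, section E) j :
  (forall j t, u j t \in hfib E j t) -> (j == 0%N) || (N <= j)%N ->
  forall t, U t -> u j t = 0.
Proof. by move=> uF jo t Ut; exact: (hcomp_hfib_out (UX Ut) jo). Qed.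

(* This is the derivative of [Q (a, b) = 0]. *)
Lemma dQ_ortho i j (a b : section E) t : i != j ->
  smooth_section U a -> smooth_section U b ->
  (forall x, a x \in hfib E i x) -> (forall x, b x \in hfib E j x) -> U t ->
  Q t (d10 D a t) (b t) + Q t (a t) (d01 D b t) = 0 /\
  Q t (d01 D a t) (b t) + Q t (a t) (d10 D b t) = 0.
Proof.
move=> ij aU bU aF bF Ut; have [<- <-] := pol_flat oU UX aU bU Ut.
have Q0 x : U x -> Q x (a x) (b x) = 0.
  by move=> Ux; exact: (Q_ortho (UX Ux) ij).
by rewrite (dz_eq oU Ut Q0) (dzbar_eq oU Ut Q0) dz_cst dzbar_cst.
Qed.

(** This is the dt-part of the derivative of Q(v_(j+1), v_j) = 0, after orthogonality removes
    [yproj j.+1] against [vproj j] and [vproj j.+1] against [wproj j]. It makes the two expressions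
    of A agree term by term. *)
Lemma Q_vw_yv j t : U t -> Q t (vproj j.+1 t) (wproj j.+1 t) = Q t (yproj j t) (vproj j t).
Proof.
move=> Ut; have Xt := UX Ut.
have jj : j.+1 != j by rewrite gtn_eqF.
have [+ _] := dQ_ortho jj (vU j.+1) (vU j) (vF _) (vF _) Ut.
rewrite d10_vproj// d01_vproj// QDl QDr QNl QNr.
rewrite (Q_ortho Xt _ (yF j.+1 t) (vF j t)) ?gtn_eqF//.
rewrite (Q_ortho Xt _ (vF j.+1 t) (wF j t)) ?gtn_eqF//.
by rewrite subr0 add0r => H; apply/esym/eqP; rewrite -subr_eq0 H.
Qed.

(** Flatness of the connection, applied to [vproj j.+1], says that the two sides have the same
    increment from [j] to [j.+1]. The induction starts at index 0, where both sides vanish because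
    the Hodge types begin later. *)
Lemma d10_w_d01_y j t : U t -> d10 D (wproj j.+1) t = d01 D (yproj j) t.
Proof.
elim: j t => [|j IH] t Ut.
  have w1 x : U x -> wproj 1 x = 0.
    move=> Ux; have := d01_vproj 0 Ux.
    have [_ ->] := d_zero_on (out0 vF (erefl : (0%N == 0%N) || _)) Ux.
    by rewrite (out0 wF (erefl : (0%N == 0%N) || _) Ux) sub0r => /esym/eqP; rewrite oppr_eq0 => /eqP.
  have [-> _] := d_zero_on w1 Ut.
  by have [_ ->] := d_zero_on (out0 yF (erefl : (0%N == 0%N) || _)) Ut.
have := conn_flat oU UX (vU j.+1) Ut.
have [vs10 vs01] := d_smooth D oU UX (vU j.+1).
have [-> _] := d_local D oU UX vs01 (d01_vproj j.+1) Ut.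
have [_ ->] := d_local D oU UX vs10 (d10_vproj j) Ut.
have [-> _] := d_sub D oU UX (wU j.+1) (wU j.+2) Ut.
have [_ ->] := d_sub D oU UX (yU j) (yU j.+1) Ut.
by rewrite IH// => /addrI /oppr_inj.
Qed.

Let fnorm t := hnorm (s t) (s t).
(** The operator acting by (-1)^q on E^(p,q), applied to [s]. It writes h(s, s) as Q(s, Cs), to
    which flatness of Q applies; since [s] is flat, every derivative falls on [Cs]. *)
Let Cs : section E := fun t => \sum_(j < N) hsgn E j *: vproj j t.

Let CsU : smooth_section U Cs.
Proof.
by apply: smooth_section_sum => // j; apply: smooth_sectionZ => //; exact: smooth_cst.
Qed.

Lemma fnormE t : U t -> fnorm t = \sum_(j < N) hsgn E j * Q t (vproj j t) (vproj j t).
Proof. by move=> Ut; rewrite /fnorm (hnormE _ _ (UX Ut)). Qed.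

Let Q_s_hfib j t w : U t -> w \in hfib E j t -> Q t (s t) w = Q t (vproj j t) w.
Proof.
move=> Ut wj; have Xt := UX Ut; rewrite -{1}(sumv Ut) Q_suml.
have [jN|jN] := ltnP j N; last first.
  by rewrite (hcomp_hfib_out Xt _ wj) ?jN ?orbT// Q0r big1// => i _; rewrite Q0r.
rewrite (bigD1 (Ordinal jN))//= big1 ?addr0// => i ij.
exact: (Q_ortho Xt _ (vF i t) wj).
Qed.

Lemma fnorm_Q t : U t -> fnorm t = Q t (s t) (Cs t).
Proof.
move=> Ut; rewrite fnormE// Q_sumr; apply: eq_bigr => j _.
by rewrite QZr hsgn_conj (Q_s_hfib Ut (vF j t)).
Qed.

(** Without signs the sum of [wproj j - wproj j.+1] telescopes to 0. The alternating signs turn the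
    difference into a sum, and its two halves are equal because [wproj] vanishes at 0 and at [N];
    hence the factor 2. *)
Lemma d01_Cs t : U t -> d01 D Cs t = 2%:R *: \sum_(j < N) hsgn E j.+1 *: wproj j.+1 t.
Proof.
move=> Ut; have zU j := smooth_sectionZ oU (smooth_cst (hsgn E j) oU) (vU j).
have [_ ->] := d_sum D (index_enum 'I_N) oU UX (fun j : 'I_N => zU j) Ut.
transitivity (\sum_(j < N) (hsgn E j *: wproj j t + hsgn E j.+1 *: wproj j.+1 t)).
  apply: eq_bigr => j _; have [_ ->] := d_scale D (hsgn E j) oU UX (vU j) Ut.
  by rewrite d01_vproj// scalerBr hsgnS scaleNr.
rewrite big_split /= (_ : \sum_(j < N) hsgn E j *: _ = \sum_(j < N) hsgn E j.+1 *: wproj j.+1 t).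
  by rewrite scaler_nat mulr2n.
have := big_ord_recr N (fun j => hsgn E j *: wproj j t) (idx := 0) (op := +%R).
rewrite big_ord_recl /= (out0 wF _ Ut) ?eqxx// scaler0 add0r => ->.
by rewrite (out0 wF _ Ut) ?leqnn ?orbT// scaler0 addr0.
Qed.

Lemma dz_fnorm t : U t ->
  dz fnorm t = 2%:R * \sum_(j < N) hsgn E j.+1 * Q t (vproj j.+1 t) (wproj j.+1 t).
Proof.
move=> Ut; rewrite (dz_eq oU Ut fnorm_Q).
have [-> _] := pol_flat oU UX sU CsU Ut.
rewrite (s_flat Ut).1 Q0l add0r d01_Cs// QZr [conjc _]rmorph_nat Q_sumr; congr (_ * _).
apply: eq_bigr => j _; by rewrite QZr hsgn_conj (Q_s_hfib Ut (wF _ t)).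
Qed.

Let Q_hcompr i t (a w : E t) : U t -> a \in hfib E i t -> Q t a w = Q t a (hcomp i w).
Proof.
move=> Ut ai; have Xt := UX Ut; rewrite -{1}(sum_hcomp w Xt) Q_sumr.
have [iN|iN] := ltnP i N; last first.
  by rewrite (hcomp_hfib_out Xt _ ai) ?iN ?orbT// Q0l big1// => k _; rewrite Q0l.
rewrite (bigD1 (Ordinal iN))//= big1 ?addr0// => k ki.
by apply: (Q_ortho Xt _ ai (hcomp_mem k w)); rewrite eq_sym.
Qed.

Let Q_s_shift j t w : U t -> (forall i, i != j -> i != j.+1 -> hcomp i w = 0) ->
  Q t (s t) w = Q t (vproj j t) w + Q t (vproj j.+1 t) w.
Proof.
move=> Ut w0; have Xt := UX Ut; rewrite -{1}(sumv Ut) Q_suml.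
(* The range is extended by zero terms so that [j] and [j.+1] are both indices, whatever [j] is. *)
have -> : \sum_(i < N) Q t (vproj i t) w = \sum_(i < N + j.+2) Q t (vproj i t) w.
  rewrite [RHS]big_split_ord /= [X in _ + X]big1 ?addr0// => i _.
  by rewrite (out0 vF _ Ut) ?Q0l// leq_addr orbT.
have jM : (j < N + j.+2)%N by lia.
have jSM : (j.+1 < N + j.+2)%N by lia.
rewrite (bigD1 (Ordinal jM))//= (bigD1 (Ordinal jSM))/=; last first.
  by rewrite -val_eqE /= gtn_eqF.
rewrite big1 ?addr0// => i /andP[]; rewrite -!val_eqE /= => i1 i2.
by rewrite (Q_hcompr _ Ut (vF i t)) w0// Q0r.
Qed.

(** By type, [d10 D (wproj j.+1)] pairs only with [vproj j] and [vproj j.+1]. Differentiating Q(v_j,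
    w_(j+1)) = 0 gives the first term. For the second, flatness replaces the derivative of
    [wproj j.+1] by that of [yproj j], and Q(v_(j+1), y_j) = 0 is differentiated. *)
Lemma Q_s_d10w j t : U t -> Q t (s t) (d10 D (wproj j.+1) t) =
  Q t (wproj j.+1 t) (wproj j.+1 t) - Q t (yproj j t) (yproj j t).
Proof.
move=> Ut; have Xt := UX Ut.
rewrite (Q_s_shift (j := j) Ut); last first.
  move=> i i1 i2; apply: (hcomp_d10 (wU j.+1) (fun t _ => wF j.+1 t) Ut) => //.
congr (_ + _).
  have jj : j != j.+1 by rewrite ltn_eqF.
  have [_ +] := dQ_ortho jj (vU j) (wU j.+1) (vF _) (wF _) Ut.
  rewrite d01_vproj// QDl QNl (Q_ortho Xt _ (wF j t) (wF j.+1 t)) ?ltn_eqF// sub0r.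
  by rewrite addrC => H; apply/eqP; rewrite -subr_eq0 H.
rewrite d10_w_d01_y//.
have jj : j.+1 != j by rewrite gtn_eqF.
have [+ _] := dQ_ortho jj (vU j.+1) (yU j) (vF _) (yF _) Ut.
rewrite d10_vproj// QDl QNl (Q_ortho Xt _ (yF j.+1 t) (yF j t)) ?gtn_eqF// subr0.
by rewrite addrC => H; apply/eqP; rewrite -addr_eq0 H.
Qed.

(** The sign change from [hsgn E j.+1] to [hsgn E j] turns the difference in [Q_s_d10w] into a sum
    of two squared norms. *)
Lemma dzbar_dz_fnorm t : U t -> dzbar (dz fnorm) t =
  2%:R * \sum_(j < N) (hsgn E j.+1 * Q t (wproj j.+1 t) (wproj j.+1 t) +
    hsgn E j * Q t (yproj j t) (yproj j t)).
Proof.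
move=> Ut; have [_ dCsU] := d_smooth D oU UX CsU.
have E1 x : U x -> dz fnorm x = Q x (s x) (d01 D Cs x).
  move=> Ux; rewrite (dz_eq oU Ux fnorm_Q).
  have [-> _] := pol_flat oU UX sU CsU Ux.
  by rewrite (s_flat Ux).1 Q0l add0r.
rewrite (dzbar_eq oU Ut E1).
have [_ ->] := pol_flat oU UX sU dCsU Ut.
rewrite (s_flat Ut).2 Q0l add0r.
have zU j := smooth_sectionZ oU (smooth_cst (hsgn E j.+1) oU) (wU j.+1).
have SU := smooth_section_sum (index_enum 'I_N) oU (fun j : 'I_N => zU j).
have [-> _] := d_local D oU UX dCsU d01_Cs Ut.
have [-> _] := d_scale D 2%:R oU UX SU Ut.
have [-> _] := d_sum D (index_enum 'I_N) oU UX (fun j : 'I_N => zU j) Ut.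
rewrite QZr [conjc _]rmorph_nat Q_sumr; congr (_ * _); apply: eq_bigr => j _.
have [-> _] := d_scale D (hsgn E j.+1) oU UX (wU j.+1) Ut.
by rewrite QZr hsgn_conj Q_s_d10w// mulrBr hsgnS !mulNr opprK.
Qed.

Lemma fnorm_subharmonic t : U t -> 0 < fnorm t ->
  (1 + hodge_eps E)%:C%C * (dz fnorm t * conjc (dz fnorm t)) <=
  fnorm t * dzbar (dz fnorm) t.
Proof.
move=> Ut f0; rewrite dzbar_dz_fnorm// dz_fnorm//.
have := hodge_quadratic_estimate (UX Ut) (vF ^~ t) (wF ^~ t) (yF ^~ t) (fun j => Q_vw_yv j Ut).
rewrite /= -fnormE// => /(_ f0).
set A := \sum_(j < _) _; set S := \sum_(j < _) _ => H.
rewrite conjcM [conjc 2%:R]rmorph_nat.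
have -> : (1 + hodge_eps E)%:C%C * (2%:R * A * (2%:R * conjc A)) =
  2%:R * ((2 * (1 + hodge_eps E))%:C%C * (A * conjc A)).
  have h2 : (2%:R : C) = 2%:C%C by rewrite -[2%:R](rmorph_nat (real_complex R)).
  by rewrite [(2 * _)%:C%C](rmorphM (real_complex R)) /= h2; ring.
by rewrite [X in _ <= X]mulrCA ler_pM2l.
Qed.

End FlatSection.

(** * The inequality in real coordinates *)

Section RealInequality.
Variable R : realType.
Local Notation C := R[i].
Local Notation Re := (@complex.Re _).
Local Notation Im := (@complex.Im _).

(** For e > 0, where g > 0, this says that g^(- e) is superharmonic. *)
Definition subharmonic_ineq (e : R) (g : R * R -> R) (p : R * R) : Prop :=
  (1 + e) * (('D_(1, 0) g p) ^+ 2 + ('D_(0, 1) g p) ^+ 2) <=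
    g p * ('D_(1, 0) ('D_(1, 0) g) p + 'D_(0, 1) ('D_(0, 1) g) p).

(** For real f, |dz f|^2 is a quarter of |grad f|^2 and [dzbar (dz f)] is a quarter of the
    Laplacian, so the factors agree on both sides. *)
Lemma real_subharmonic (U : set C) (f : C -> C) (e : R) : openC U ->
  smooth_on U f -> (forall t, U t -> Im (f t) = 0) ->
  forall t, U t ->
  (1 + e)%:C%C * (dz f t * conjc (dz f t)) <= f t * dzbar (dz f) t ->
  subharmonic_ineq e (re_fun f) (Re t, Im t).
Proof.
rewrite /subharmonic_ineq => oU fU f0 t Ut; set g := re_fun f; set p := (Re t, Im t).
have [gC _] := fU 2%N.
have im0 q e' : plane U q -> 'D_e' (im_fun f) q = 0.
  move=> Uq; rewrite -(derive_cst (0 : R) q e'); apply: near_eq_derive.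
  by apply: (near_open oU Uq) => q' Uq'; rewrite /im_fun f0.
have dzE x : U x -> dz f x = ('D_(1, 0) g (Re x, Im x) / 2 +i* (- ('D_(0, 1) g (Re x, Im x) / 2)))%C.
  move=> Ux; have Px : plane U (Re x, Im x) by rewrite /plane /= -complexE.
  rewrite /dz /pderiv !im0// -/g.
  have -> : (2%:R : C)^-1 = (2^-1)%:C%C by rewrite -[2%:R](rmorph_nat (real_complex R)) -fmorphV.
  move: ('D_(1, 0) g _) ('D_(0, 1) g _) => a b.
  by apply/eqP; rewrite eq_complex /=; apply/andP; split; apply/eqP; field.
have Ck1 e' : Ck 1 (plane U) ('D_e' g) -> forall a q, plane U q -> a = (1, 0) \/ a = (0, 1) ->
    forall c : R, is_derive q a (fun q => 'D_e' g q * c) ('D_a ('D_e' g) q * c).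
  move=> C1 a q Uq aE c; have [d1 d2] := Ck_is_derive C1 Uq.
  have da : is_derive q a ('D_e' g) ('D_a ('D_e' g) q) by case: aE => ->; [exact: d1|exact: d2].
  have := is_deriveM da (is_derive_cst (c : R) q a).
  by move=> D; apply: is_derive_eq D _; rewrite scaler0 add0r /GRing.scale /= mulrC.
have Up : plane U p by rewrite /plane /= -complexE.
case: (gC) => _ [_ g1 g2].
have E1 : Re (dzbar (dz f) t) = ('D_(1, 0) ('D_(1, 0) g) p + 'D_(0, 1) ('D_(0, 1) g) p) / 4.
  have -> : dzbar (dz f) t = dzbar (fun x => ('D_(1, 0) g (Re x, Im x) / 2 +i* (- ('D_(0, 1) g (Re x, Im x) / 2)))%C) t.
    exact: (dzbar_eq oU Ut dzE).
  rewrite /dzbar /pderiv.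
  have -> : (2%:R : C)^-1 = (2^-1)%:C%C by rewrite -[2%:R](rmorph_nat (real_complex R)) -fmorphV.
  rewrite [re_fun _](_ : _ = (fun q => 'D_(1, 0) g q * 2^-1)); last by apply/funext => -[].
  rewrite [im_fun _](_ : _ = (fun q => 'D_(0, 1) g q * - 2^-1)); last first.
    by apply/funext => -[a b]; rewrite /im_fun /= mulrN.
  have [_ ->] := Ck1 _ g1 (1, 0) p Up (or_introl erefl) 2^-1.
  have [_ E2] := Ck1 _ g2 (0, 1) p Up (or_intror erefl) (- 2^-1).
  rewrite E2 /=; move: ('D_(1, 0) _ p) ('D_(0, 1) _ p) => a b; by field.
have reM (x y : C) : Re (x * y) = Re x * Re y - Im x * Im y by case: x y => ? ? [].
move: E1 (dzE t Ut); move: (dzbar (dz f) t) (dz f t) => Z Y E1 YE.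
rewrite lecE => /andP[_]; rewrite !reM E1 f0// YE /= -/p mul0r !subr0.
rewrite (_ : Re (f t) = g p); last by rewrite /g /p /re_fun /= -complexE.
move: ('D_(1, 0) ('D_(1, 0) g) p) ('D_(0, 1) ('D_(0, 1) g) p) => c d.
move: (g p) ('D_(1, 0) g p) ('D_(0, 1) g p) => G a b.
rewrite !mul0r ?subr0 => H.
have H4 : 0 <= 4 :> R by rewrite ler0n.
have := ler_wpM2l H4 H.
rewrite (_ : 4 * _ = (1 + e) * (a ^+ 2 + b ^+ 2)); last by field.
by rewrite (_ : 4 * _ = G * (c + d)); last by field.
Qed.

End RealInequality.

(** * Multi-valued flat sections as local flat sections on the disk *)

Section PullDown.
Variables (R : realType) (n : int) (E : pvhs (@punctured_disk R) n).
Local Notation C := R[i].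
Local Notation Re := (@complex.Re _).
Local Notation Im := (@complex.Im _).
Local Notation D := (conn E).
Variable v : msection E.
Hypothesis v_flat : flat_msection D v.

Definition mnorm (z : C) : R := Re (hnorm (v z) (v z)).

Variables (y0 : R) (i : chart E).

Definition log_nbhs : set C := @logdom R y0 `&` dom i.
(** The vector [v (clog y0 t)] lies in the fibre over [cexp (clog y0 t)], which is equal but not
    convertible to the fibre over [t]. Only its coordinates in the chart [i] are used, so no
    transport between fibres occurs. *)
Definition log_section : section E := fun t =>
  \sum_k mcoord i k v (clog y0 t) *: frame i k t.

Lemma dom_sub : dom i `<=` punctured_disk.
Proof. by move=> t it; rewrite -(dom_cover E); exists i. Qed.

Lemma openC_log_nbhs : openC log_nbhs.
Proof. exact: (openCI (@openC_logdom R y0) (@dom_open _ _ E i)). Qed.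

Lemma log_nbhs_sub : log_nbhs `<=` punctured_disk.
Proof. by move=> t [_ /dom_sub]. Qed.

Let V : set C := half_plane `&` cexp @^-1` dom i.

Let oV : openC V.
Proof. exact: (openCI (@openC_half_plane R) (openC_preimage_cexp (@dom_open _ _ E i))). Qed.

Let clogV t : log_nbhs t -> V (clog y0 t).
Proof.
move=> [Lt it]; split; last by rewrite /preimage /= cexp_clog.
by apply/punctured_disk_cexp; rewrite cexp_clog//; exact: dom_sub.
Qed.

Lemma smooth_frame k : smooth_section (dom i) (frame i k).
Proof. by move=> j l; exact: triv_smooth. Qed.

Let coefU k : smooth_on log_nbhs (fun t => mcoord i k v (clog y0 t)).
Proof.
apply: (smooth_comp_clog openC_log_nbhs oV _ clogV); first by move=> t [].
exact: v_flat.1.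
Qed.

Let frameU k : smooth_section log_nbhs (frame i k).
Proof. exact: smooth_section_sub (@subIsetr _ _ _) (smooth_frame k). Qed.

Lemma smooth_log_section : smooth_section log_nbhs log_section.
Proof.
apply: smooth_section_sum; first exact: openC_log_nbhs.
by move=> k; apply: smooth_sectionZ; [exact: openC_log_nbhs|exact: coefU|exact: frameU].
Qed.

(** With [t] a variable, the equation [cexp z = t] is eliminated once for all dependent fibres; it
    is applied later to [z = clog y0 t]. *)
Lemma pull_transport z t : cexp z = t -> half_plane z -> dom i t ->
  \sum_k (dz (mcoord i k v) z *: frame i k t
    + (mcoord i k v z * t) *: d10 D (frame i k) t) = 0 /\
  \sum_k (dzbar (mcoord i k v) z *: frame i k t
    + (mcoord i k v z * conjc t) *: d01 D (frame i k) t) = 0.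
Proof. by move=> <- hz iz; exact: v_flat.2. Qed.

Lemma log_section_flat t : log_nbhs t ->
  d10 D log_section t = 0 /\ d01 D log_section t = 0.
Proof.
move=> Ut; have oU := openC_log_nbhs; have UX := log_nbhs_sub.
have [Lt it] := Ut.
have sub : log_nbhs `<=` logdom y0 by move=> x [].
have zU k := smooth_sectionZ oU (coefU k) (frameU k).
have [-> ->] := d_sum D (index_enum 'I_(rank E)) oU UX zU Ut.
have t0 : t != 0.
  by have := UX _ Ut; rewrite /punctured_disk /= normr_gt0 => /andP[].
have [p10 p01] := pull_transport (cexp_clog Lt) (clogV Ut).1 it.
split.
  (* The pulled-back equation divided by [t] is the equation on the disk, term by term. *)
  rewrite -[RHS](scaler0 _ t^-1) -[X in _ = _ *: X]p10 scaler_sumr; apply: eq_bigr => k _.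
  have [-> _] := d_leibniz D oU UX (coefU k) (frameU k) Ut.
  have [-> _] := dz_comp_clog oV sub clogV (v_flat.1 i k) Ut.
  by rewrite scalerDr !scalerA [t^-1 * (_ * t)]mulrCA mulVf// mulr1 [t^-1 * _]mulrC.
have ct0 : conjc t != 0 by rewrite conjc_eq0.
rewrite -[RHS](scaler0 _ (conjc t)^-1) -[X in _ = _ *: X]p01 scaler_sumr; apply: eq_bigr => k _.
have [_ ->] := d_leibniz D oU UX (coefU k) (frameU k) Ut.
have [_ ->] := dz_comp_clog oV sub clogV (v_flat.1 i k) Ut.
by rewrite scalerDr !scalerA [(conjc t)^-1 * (_ * conjc t)]mulrCA mulVf// mulr1 [(conjc t)^-1 * _]mulrC.
Qed.

Lemma frame_decomp t (w : E t) : dom i t ->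
  \sum_k (triv i t w) k 0 *: frame i k t = w.
Proof.
move=> it; have inj : lker (triv i t) == 0%VS.
  by apply/lker0P; exact: bij_inj (triv_bij it).
rewrite -[RHS](lker0_lfunK inj) {2}(matrix_sum_delta (triv i t w)) linear_sum.
by apply: eq_bigr => k _; rewrite big_ord1 linearZ.
Qed.

Lemma mnorm_transport z t : cexp z = t -> dom i t ->
  let w := \sum_k mcoord i k v z *: frame i k t in
  Re (hnorm w w) = mnorm z.
Proof. by move=> <- it; rewrite /mcoord /= frame_decomp. Qed.

Definition log_norm (t : C) : C := hnorm (log_section t) (log_section t).

Lemma log_normE t : log_nbhs t -> log_norm t = (mnorm (clog y0 t))%:C%C.
Proof.
move=> Ut; have [Lt it] := Ut.
have [r rE] := complex_ge0E (hnorm_ge0 (log_section t) (log_nbhs_sub Ut)).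
rewrite -(mnorm_transport (cexp_clog Lt) it) /= -/(log_section t) /log_norm.
by rewrite rE.
Qed.

Lemma smooth_log_norm : smooth_on log_nbhs log_norm.
Proof.
exact: (metric_smooth openC_log_nbhs log_nbhs_sub smooth_log_section smooth_log_section).
Qed.

Lemma log_norm_subharmonic p : plane log_nbhs p -> 0 < re_fun log_norm p ->
  subharmonic_ineq (hodge_eps E) (re_fun log_norm) p.
Proof.
case: p => a b Up g0.
apply: (real_subharmonic openC_log_nbhs smooth_log_norm _ Up).
  by move=> t Ut; rewrite log_normE.
apply: (fnorm_subharmonic openC_log_nbhs log_nbhs_sub smooth_log_section log_section_flat Up).
have [r rE] := complex_ge0E (hnorm_ge0 (log_section (a +i* b)%C) (log_nbhs_sub Up)).
move: g0; rewrite /re_fun /= /log_norm rE /= => g0.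
by rewrite (_ : 0 = 0%:C%C)// ltcR.
Qed.

End PullDown.

(** * The maximum principle *)

Section MaximumTests.
Variable R : realType.

Lemma is_derive_line_at (V : normedModType R) (f : V -> R) (p v : V) (x d : R) :
  is_derive (x *: v + p) v f d -> is_derive x 1 (fun h : R => f (h *: v + p)) d.
Proof.
move=> /is_derive_cvg fd; apply/is_derive_cvg; move: fd.
apply: cvg_trans; apply/near_eq_cvg; near=> h.
by rewrite addrA -scalerDl [h *: 1]mulr1.
Unshelve. all: by end_near. Qed.

(** If [c] were positive, [f1] would be positive just to the right of 0, and by the mean value
    theorem [f] would exceed [f 0] there. *)
Lemma max_test1 (f f1 : R -> R) (c : R) :
  (\forall x \near (0 : R), is_derive (x : R) 1 f (f1 x)) -> is_derive (0 : R) 1 f1 c ->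
  (\forall x \near (0 : R), f x <= f 0) -> f1 0 = 0 /\ c <= 0.
Proof.
move=> fd f1d fmax.
have /nbhs_ballP[r /= r0 rP] : \forall x \near (0 : R),
    is_derive (x : R) 1 f (f1 x) /\ f x <= f 0 by exact: filterI.
have inr (x : R) : x \in `](- r), r[%R -> is_derive (x : R) 1 f (f1 x) /\ f x <= f 0.
  by rewrite in_itv /= => xr; apply: rP; rewrite /ball /= sub0r normrN ltr_norml.
have f10 : f1 0 = 0.
  have I0 : (0 : R) \in `](- r), r[%R by rewrite in_itv /= oppr_lt0 r0.
  have [[_ <-] _] := inr 0 I0.
  suff [_] : is_derive (0 : R) 1 f 0 by [].
  apply: (@derive1_at_max _ f (- r) r) => //.
  - by rewrite ge0_cp ?ltW.
  - by move=> t /inr[[]].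
  - by move=> t /inr[].
split=> //; rewrite leNgt; apply/negP => c0.
have /is_derive_cvg/cvgrPdist_lt/(_ c c0) [s /= s0 sP] := f1d.
pose x := Num.min r s / 2.
have x0 : 0 < x by rewrite divr_gt0// lt_min r0 s0.
have xr : x < r.
  by rewrite ltr_pdivrMr// (@le_lt_trans _ _ r)// ?ge_min ?lexx//; lra.
have xs : x < s.
  by rewrite ltr_pdivrMr// (@le_lt_trans _ _ s)// ?ge_min ?lexx ?orbT//; lra.
have in0x (y : R) : 0 <= y -> y <= x -> is_derive (y : R) 1 f (f1 y).
  by move=> y0 yx; apply: (inr y _).1; rewrite in_itv /=; lra.
have [|||y yI E] := @MVT R f f1 0 x.
- exact: x0.
- by move=> y; rewrite in_itv /= => /andP[y0 yx]; apply: in0x; exact: ltW.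
- apply: derivable_within_continuous => y; rewrite in_itv /= => /andP[y0 yx].
  by apply: ex_derive; exact: in0x.
move: yI; rewrite in_itv /= => /andP[y0 yx].
have f1y : 0 < f1 y.
  have := sP y; rewrite /ball /= sub0r normrN gtr0_norm// => /(_ (lt_trans yx xs)).
  move=> /(_ (lt0r_neq0 y0)); rewrite f10 subr0 addr0 [y *: 1]mulr1 => H.
  have : 0 < y^-1 * f1 y by move: H; rewrite ltr_norml; lra.
  by rewrite pmulr_rgt0// invr_gt0.
have : f x <= f 0 by apply: (inr x _).2; rewrite in_itv /=; lra.
by rewrite leNgt -subr_gt0 E subr0 mulr_gt0.
Qed.

Lemma max_test (f f1 : R * R -> R) (p e : R * R) (c : R) :
  (\forall q \near p, is_derive q e f (f1 q)) -> is_derive p e f1 c ->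
  (\forall q \near p, f q <= f p) -> f1 p = 0 /\ c <= 0.
Proof.
move=> fd f1d fmax.
have line : (fun x : R => x *: e + p) @ (0 : R) --> p.
  suff : (fun x : R => x *: e + p) @ (0 : R) --> 0 *: e + p by rewrite scale0r add0r.
  by apply: cvgD; [apply: cvgZr_tmp|exact: cvg_cst].
have := @max_test1 (fun x => f (x *: e + p)) (fun x => f1 (x *: e + p)) c.
rewrite scale0r add0r; apply.
- have := line _ fd; rewrite /= => H; near=> x; apply: is_derive_line_at; near: x; exact: H.
- by apply: is_derive_line_at; rewrite scale0r add0r.
- exact: (line _ fmax).
Unshelve. all: by end_near. Qed.

(** (P, Q) is the point t, [n] is |t|^2, [G] is the value of g, and [c], [s] are the cosine and sine
    of k (x1 - log|t|). The last four hypotheses are the first- and second-order conditions at a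
    maximum of ln g + b arg t + M ln s. The gradients of log|t| and arg t are orthogonal of squared
    length 1 / n, so with m = k c / s one gets e (b^2 + M^2 m^2) <= M (k^2 + m^2). Exactly for M e =
    1 the terms in m cancel. *)
Lemma log_max_algebra (G gx gy gxx gyy b M k s c P Q n e : R) :
  n = P ^+ 2 + Q ^+ 2 -> 0 < n -> 0 < G -> 0 < s -> c ^+ 2 + s ^+ 2 = 1 ->
  0 < M -> M * e = 1 ->
  (1 + e) * (gx ^+ 2 + gy ^+ 2) <= G * (gxx + gyy) ->
  gx / G + b * (- Q / n) - M * (k * c / s * (P / n)) = 0 ->
  gy / G + b * (P / n) - M * (k * c / s * (Q / n)) = 0 ->
  gxx / G - (gx / G) ^+ 2 + b * (2 * P * Q / n ^+ 2)
    - M * (k ^+ 2 * (P / n) ^+ 2 + (k * c / s * (P / n)) ^+ 2 +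
           k * c / s * (n^-1 - 2 * P ^+ 2 / n ^+ 2)) <= 0 ->
  gyy / G - (gy / G) ^+ 2 - b * (2 * P * Q / n ^+ 2)
    - M * (k ^+ 2 * (Q / n) ^+ 2 + (k * c / s * (Q / n)) ^+ 2 +
           k * c / s * (n^-1 - 2 * Q ^+ 2 / n ^+ 2)) <= 0 ->
  b ^+ 2 <= (M * k) ^+ 2.
Proof.
move=> nE n0 G0 s0 cs M0 Me.
have nn0 := lt0r_neq0 n0; have G0' := lt0r_neq0 G0; have s0' := lt0r_neq0 s0.
have -> : gxx / G = G * gxx / G ^+ 2 by field.
have -> : gyy / G = G * gyy / G ^+ 2 by field.
set u := gx / G; set v := gy / G; set m := k * c / s.
have gxE : gx = u * G by rewrite divfK.
have gyE : gy = v * G by rewrite divfK.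
move=> H /eqP + /eqP +; rewrite !subr_eq0 => /eqP uE /eqP vE S1 S2.
have {}uE : u = (b * Q + M * m * P) / n.
  have -> : u = M * (m * (P / n)) - b * (- Q / n) by rewrite -uE; ring.
  by field.
have {}vE : v = (M * m * Q - b * P) / n.
  have -> : v = M * (m * (Q / n)) - b * (P / n) by rewrite -vE; ring.
  by field.
have uv : u ^+ 2 + v ^+ 2 = (b ^+ 2 + (M * m) ^+ 2) / n.
  by rewrite uE vE nE; field; rewrite -nE.
have PQ : (P / n) ^+ 2 + (Q / n) ^+ 2 = n^-1 by rewrite nE; field; rewrite -nE.
have H' : (1 + e) * (u ^+ 2 + v ^+ 2) <= G * gxx / G ^+ 2 + G * gyy / G ^+ 2.
  rewrite -mulrDl -mulrDr ler_pdivlMr ?exprn_gt0//.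
  by apply: le_trans H; rewrite gxE gyE le_eqVlt; apply/orP; left; apply/eqP; ring.
(* This is the harmonicity of log|t|. *)
have L0 : (n^-1 - 2 * P ^+ 2 / n ^+ 2) + (n^-1 - 2 * Q ^+ 2 / n ^+ 2) = 0.
  by rewrite nE; field; rewrite -nE.
have K : e * (b ^+ 2 + (M * m) ^+ 2) / n <= M * (k ^+ 2 + m ^+ 2) / n.
  have -> : M * (k ^+ 2 + m ^+ 2) / n =
     M * (k ^+ 2 * (P / n) ^+ 2 + (m * (P / n)) ^+ 2 + m * (n^-1 - 2 * P ^+ 2 / n ^+ 2)) +
     M * (k ^+ 2 * (Q / n) ^+ 2 + (m * (Q / n)) ^+ 2 + m * (n^-1 - 2 * Q ^+ 2 / n ^+ 2)).
    transitivity (M * ((k ^+ 2 + m ^+ 2) * ((P / n) ^+ 2 + (Q / n) ^+ 2)) + M * m *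
      ((n^-1 - 2 * P ^+ 2 / n ^+ 2) + (n^-1 - 2 * Q ^+ 2 / n ^+ 2))); last by ring.
    by rewrite L0 PQ mulr0 addr0 mulrA.
  have -> : e * (b ^+ 2 + (M * m) ^+ 2) / n = e * (u ^+ 2 + v ^+ 2) by rewrite uv; ring.
  move: H' S1 S2; rewrite mulrDl mul1r; lra.
have {}K : b ^+ 2 + (M * m) ^+ 2 <= M * (M * (k ^+ 2 + m ^+ 2)).
  have := K; rewrite ler_pM2r ?invr_gt0// => /(ler_wpM2l (ltW M0)).
  by rewrite [M * (e * _)]mulrA Me mul1r.
by have -> : (M * k) ^+ 2 = M * (M * (k ^+ 2 + m ^+ 2)) - (M * m) ^+ 2; [ring|lra].
Qed.

End MaximumTests.

(** * The maximum test in the coordinate of the disk *)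

Section LogarithmicMaximum.
Variable R : realType.
Variables (y0 b k x1 M e : R) (g : R * R -> R) (p : R * R) (W : set (R * R)).
Hypotheses (oW : open W) (WL : W `<=` plane (logdom y0)) (Wp : W p).
Hypotheses (gC : Ck 2 W g) (M0 : 0 < M) (Me : M * e = 1).

Let arg (q : R * R) : R := k * (x1 - lograd q).
(** The logarithm of the test function, written in the coordinate t: log|t| and the argument stand
    for x and y. *)
Let pot (q : R * R) : R := ln (g q) + b * logarg y0 q + M * ln (sin (arg q)).
Let nrm (q : R * R) : R := q.1 ^+ 2 + q.2 ^+ 2.
Let pot1 (v q : R * R) : R := (g q)^-1 * 'D_v g q +
  b * ((q.1 * v.2 - q.2 * v.1) / nrm q) +
  M * ((sin (arg q))^-1 * (cos (arg q) * (k * - ((q.1 * v.1 + q.2 * v.2) / nrm q)))).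

Let is_derive_arg q v : W q ->
  is_derive q v arg (k * - ((q.1 * v.1 + q.2 * v.2) / nrm q)).
Proof.
move=> Wq; have dl := is_derive_lograd v (logdom_norm_gt0 (WL Wq)).
have D := is_deriveM (is_derive_cst (k : R) q v) (is_deriveB (is_derive_cst (x1 : R) q v) dl).
by apply: is_derive_eq D _; rewrite scaler0 addr0 sub0r.
Qed.

Let is_derive_pot q v : W q -> v = (1, 0) \/ v = (0, 1) -> 0 < g q ->
  0 < sin (arg q) -> is_derive q v pot (pot1 v q).
Proof.
move=> Wq vE g0 s0.
have dg : is_derive q v g ('D_v g q).
  by have [d1 d2] := Ck_is_derive gC Wq; case: vE => ->; [exact: d1|exact: d2].
have da := is_derive_arg v Wq.
have dth := is_derive_logarg v (WL Wq).
have D := is_deriveD (is_deriveD (is_derive_comp1 dg (is_derive1_ln g0))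
    (is_deriveM (is_derive_cst (b : R) q v) dth))
  (is_deriveM (is_derive_cst (M : R) q v)
    (is_derive_comp1 (is_derive_comp1 da (is_derive_sin _)) (is_derive1_ln s0))).
by apply: is_derive_eq D _; rewrite !scaler0 !addr0.
Qed.

Let is_derive_dot (q v w : R * R) :
  is_derive q v (fun q : R * R => q.1 * w.1 + q.2 * w.2) (v.1 * w.1 + v.2 * w.2).
Proof.
have D := is_deriveD (is_deriveM (is_derive_fst_proj q v) (is_derive_cst (w.1 : R) q v))
  (is_deriveM (is_derive_snd_proj q v) (is_derive_cst (w.2 : R) q v)).
by apply: is_derive_eq D _; rewrite !scaler0 !add0r /GRing.scale /=; ring.
Qed.

Let is_derive_nrm (q v : R * R) :
  is_derive q v nrm (2 * (q.1 * v.1 + q.2 * v.2)).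
Proof.
have d1 := is_derive_fst_proj q v; have d2 := is_derive_snd_proj q v.
have D := is_deriveD (is_deriveM d1 d1) (is_deriveM d2 d2).
by apply: is_derive_eq D _; rewrite /GRing.scale /=; ring.
Qed.

Let is_derive_quot (w v : R * R) : is_derive p v
  (fun q : R * R => (q.1 * w.1 + q.2 * w.2) / nrm q)
  ((v.1 * w.1 + v.2 * w.2) / nrm p -
   2 * (p.1 * v.1 + p.2 * v.2) * (p.1 * w.1 + p.2 * w.2) / nrm p ^+ 2).
Proof.
have n0 := lt0r_neq0 (logdom_norm_gt0 (WL Wp)).
have D := is_deriveM (is_derive_dot p v w) (is_deriveV_fun n0 (is_derive_nrm p v)).
apply: is_derive_eq D _; rewrite /GRing.scale /= -/(nrm p).
by move: n0; rewrite -/(nrm p) => n0; field.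
Qed.

Let is_derive_pot1 v : v = (1, 0) \/ v = (0, 1) -> 0 < g p -> 0 < sin (arg p) ->
  let L := (p.1 * v.1 + p.2 * v.2) / nrm p in
  let d := k * cos (arg p) / sin (arg p) in
  is_derive p v (pot1 v)
   ('D_v ('D_v g) p / g p - ('D_v g p / g p) ^+ 2 +
    b * (- 2 * (p.1 * v.1 + p.2 * v.2) * (p.1 * v.2 - p.2 * v.1) / nrm p ^+ 2) -
    M * (k ^+ 2 * L ^+ 2 + (d * L) ^+ 2 +
      d * ((nrm p)^-1 - 2 * (p.1 * v.1 + p.2 * v.2) ^+ 2 / nrm p ^+ 2))).
Proof.
move=> vE g0 s0 L d; have n0 : nrm p != 0 := lt0r_neq0 (logdom_norm_gt0 (WL Wp)).
have vv : v.1 * v.1 + v.2 * v.2 = 1 by case: vE => -> /=; ring.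
have dg : is_derive p v g ('D_v g p).
  by have [d1 d2] := Ck_is_derive gC Wp; case: vE => ->; [exact: d1|exact: d2].
have dgg : is_derive p v ('D_v g) ('D_v ('D_v g) p).
  have [g1 g2] : Ck 1 W ('D_(1, 0) g) /\ Ck 1 W ('D_(0, 1) g).
    by case: gC => _ [_ g1 g2]; split; [exact: g1|exact: g2].
  have [d1 _] := Ck_is_derive g1 Wp; have [_ d2] := Ck_is_derive g2 Wp.
  by case: vE => ->; [exact: d1|exact: d2].
have da := is_derive_arg v Wp.
have ds := is_derive_comp1 da (is_derive_sin (arg p)).
have dc := is_derive_comp1 da (is_derive_cos (arg p)).
(* The area form of [p] and [v] is the scalar product of [p] with a rotated [v], so one quotient
   rule covers both log|t| and the argument. *)
have dT := is_derive_quot (v.2, - v.1) v; have dL := is_derive_quot v v.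
have D := is_deriveD (is_deriveD (is_deriveM (is_deriveV_fun (lt0r_neq0 g0) dg) dgg)
    (is_deriveM (is_derive_cst (b : R) p v) dT))
  (is_deriveM (is_derive_cst (M : R) p v) (is_deriveM (is_deriveV_fun (lt0r_neq0 s0) ds)
    (is_deriveM dc (is_deriveM (is_derive_cst (k : R) p v) (is_deriveN dL))))).
have -> : pot1 v = (fun q => (g q)^-1) * 'D_v g +
    cst b * (fun q : R * R => (q.1 * (v.2, - v.1).1 + q.2 * (v.2, - v.1).2) / nrm q) +
    cst M * ((fun q => (sin (arg q))^-1) * ((fun q => cos (arg q)) *
      (cst k * - (fun q : R * R => (q.1 * v.1 + q.2 * v.2) / nrm q)))).
  by apply/funext => q; rewrite /pot1 !fctE /= [q.2 * - v.1]mulrN.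
apply: is_derive_eq D _; rewrite !scaler0 !addr0 !fctE /GRing.scale /= /L /d.
move: vv n0 g0 s0; rewrite -/(nrm p).
move: ('D_v ('D_v g) p) => gvv; move: ('D_v g p) => gv; move: (g p) => G.
move: (sin _) (cos _) (nrm p) (p.1) (p.2) (v.1) (v.2) => s c n' P Q v1 v2 vv n0 g0 s0.
have g0' := lt0r_neq0 g0; have s0' := lt0r_neq0 s0.
rewrite [v1 * v2 + v2 * - v1](_ : _ = 0); last by ring.
by rewrite vv; field; rewrite n0 g0' s0'.
Qed.

Lemma no_log_max : (\forall q \near p, 0 < g q) ->
  (\forall q \near p, 0 < sin (k * (x1 - lograd q))) ->
  subharmonic_ineq e g p ->
  (\forall q \near p, ln (g q) + b * logarg y0 q + M * ln (sin (k * (x1 - lograd q))) <=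
     ln (g p) + b * logarg y0 p + M * ln (sin (k * (x1 - lograd p)))) ->
  b ^+ 2 <= (M * k) ^+ 2.
Proof.
move=> ng ns sub nmax.
have g0 := nbhs_singleton ng; have s0 := nbhs_singleton ns.
have nW : \forall q \near p, W q by exact: (near_open oW Wp).
have np (v : R * R) : v = (1, 0) \/ v = (0, 1) -> \forall q \near p, is_derive (q : R * R) v pot (pot1 v q).
  by move=> vE; apply: filterS3 nW ng ns => q Wq gq sq; exact: is_derive_pot.
have v1 : (1, 0) = (1, 0) :> R * R \/ (1, 0) = (0, 1) :> R * R by left.
have v2 : (0, 1) = (1, 0) :> R * R \/ (0, 1) = (0, 1) :> R * R by right.
have [E1 S1] := max_test (np _ v1) (is_derive_pot1 v1 g0 s0) nmax.
have [E2 S2] := max_test (np _ v2) (is_derive_pot1 v2 g0 s0) nmax.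
move: E1 S1 E2 S2 sub; rewrite /pot1 /subharmonic_ineq /=.
rewrite !mulr0 !mulr1 ?subr0 ?sub0r ?addr0 ?add0r => E1 S1 E2 S2 sub.
apply: (@log_max_algebra R (g p) ('D_(1, 0) g p) ('D_(0, 1) g p)
  ('D_(1, 0) ('D_(1, 0) g) p) ('D_(0, 1) ('D_(0, 1) g) p)
  b M k (sin (arg p)) (cos (arg p)) p.1 p.2 (nrm p) e) => //.
- exact: logdom_norm_gt0 (WL Wp).
- exact: cos2Dsin2.
- by rewrite -[RHS]E1; ring.
- by rewrite -[RHS]E2; ring.
- by apply: le_trans S1; rewrite le_eqVlt; apply/orP; left; apply/eqP; ring.
- by apply: le_trans S2; rewrite le_eqVlt; apply/orP; left; apply/eqP; ring.
Qed.

End LogarithmicMaximum.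

(** * Monodromy and the maximum over a strip *)

Section GlobalArgument.
Variables (R : realType) (n : int) (E : pvhs (@punctured_disk R) n).
Local Notation C := R[i].
Local Notation Re := (@complex.Re _).
Local Notation Im := (@complex.Im _).
Local Notation D := (conn E).
Variable v : msection E.
Hypothesis v_flat : flat_msection D v.

Definition mnorm2 (q : R * R) : R := mnorm v (q.1 +i* q.2)%C.

Lemma plane_ReIm (U : set C) t : U t -> plane U (Re t, Im t).
Proof. by rewrite /plane /= -complexE. Qed.

Lemma re_fun_ReIm (f : C -> C) t : re_fun f (Re t, Im t) = Re (f t).
Proof. by rewrite /re_fun /= -complexE. Qed.

Lemma chart_at (t : C) : punctured_disk t -> exists i : chart E, dom i t.
Proof.
move=> Xt; have : (\bigcup_i @dom _ _ E i) t by rewrite dom_cover.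
by move=> [i _ it]; exists i.
Qed.

Lemma mnorm_ge0 z : half_plane z -> 0 <= mnorm v z.
Proof.
move=> /punctured_disk_cexp zX; have := hnorm_ge0 (v z) zX.
by rewrite lecE /= => /andP[].
Qed.

Lemma mnorm_gt0 z : half_plane z -> v z != 0 -> 0 < mnorm v z.
Proof.
move=> /punctured_disk_cexp zX /(hnorm_gt0 zX).
by rewrite ltcE /= => /andP[].
Qed.

Lemma hnorm_ecast t t' (e : t = t') (x : E t) :
  hnorm (ecast t (E t) e x) (ecast t (E t) e x) = hnorm x x.
Proof. by case: _ / e. Qed.

Lemma hnormZ t (a : C) (x : E t) : punctured_disk t ->
  hnorm (a *: x) (a *: x) = a * conjc a * hnorm x x.
Proof.
move=> Xt; rewrite !hnormE// mulr_sumr; apply: eq_bigr => j _.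
have -> : hcomp j (a *: x) = a *: hcomp j x by exact: linearZ.
by rewrite QZl QZr; ring.
Qed.

Lemma mnorm_monodromy lambda z : half_plane z ->
  (forall z, half_plane z -> monodromy v z = lambda *: v z) ->
  mnorm v (z - two_pi_i R) = (Re lambda ^+ 2 + Im lambda ^+ 2) * mnorm v z.
Proof.
move=> hz mono; have := mono z hz; rewrite /monodromy => H.
rewrite /mnorm -(hnorm_ecast (cexpB2pi z) (v (z - two_pi_i R))) H.
rewrite hnormZ; last exact/punctured_disk_cexp.
have [r ->] := complex_ge0E (hnorm_ge0 (v z) (iffRL (punctured_disk_cexp z) hz)).
by case: lambda {mono H} => a b /=; ring.
Qed.

Lemma mnorm2_log_norm (q : R * R) (i : chart E) (y0 : R) :
  dom i (cexp (q.1 +i* q.2)%C) -> `|q.2 - y0| < pi / 2 ->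
  re_fun (log_norm v y0 i) (Re (cexp (q.1 +i* q.2)%C), Im (cexp (q.1 +i* q.2)%C)) = mnorm2 q.
Proof.
move=> iq qy; rewrite re_fun_ReIm log_normE; first by rewrite clog_cexp.
by split => //; exact: logdom_cexp.
Qed.

(** Continuity comes from the disk: near [q] the norm is the smooth function [log_norm] of one
    branch, composed with [cexp]. *)
Lemma mnorm2_continuous (q : R * R) : q.1 < 0 -> {for q, continuous mnorm2}.
Proof.
move=> q0; have qX : punctured_disk (cexp (q.1 +i* q.2)%C) by exact/punctured_disk_cexp.
have [i iq] := chart_at qX.
have oU := @openC_log_nbhs R n E q.2 i.
have [sC _] := smooth_log_norm v_flat q.2 i 0%N.
have pi2 : 0 < pi / 2 :> R by rewrite divr_gt0 ?pi_gt0.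
have Up : plane (log_nbhs q.2 i)
    (Re (cexp (q.1 +i* q.2)%C), Im (cexp (q.1 +i* q.2)%C)).
  apply: plane_ReIm; split=> //; apply: logdom_cexp.
  by rewrite /= subrr normr0.
have gc := cvg_comp _ _ (@cexp_continuous R q) (Ck_continuous sC Up).
have qq : `|q.2 - q.2| < pi / 2 by rewrite subrr normr0.
suff : mnorm2 @ q --> mnorm2 q by [].
rewrite -(mnorm2_log_norm iq qq).
apply: cvg_trans gc; apply: near_eq_cvg.
have oP := openC_preimage_cexp (@dom_open _ _ E i).
have n1 : \forall q' \near q, dom i (cexp (q'.1 +i* q'.2)%C).
  by apply: (near_open oP) => //; exact: iq.
have n2 : \forall q' \near q, `|q'.2 - q.2| < pi / 2.
  have : snd @ q --> q.2 by exact: cvg_snd.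
  by move/cvgrPdist_lt/(_ _ pi2); apply: filterS => q'; rewrite distrC.
apply: filterS2 n1 n2 => q' iq' qq'.
by rewrite -(mnorm2_log_norm iq' qq').
Qed.

(** 1 / eps is a natural number, so the sine enters through an ordinary power and the test function
    stays continuous where the sine vanishes. *)
Let M : nat := (4 * hodge_len E ^ 2)%N.

Let M_eps : (M%:R : R) * hodge_eps E = 1.
Proof.
rewrite /M /hodge_eps natrM natrX divff//.
by rewrite mulf_neq0// expf_neq0// lt0r_neq0// hodge_len_gt0.
Qed.

Let M0 : 0 < (M%:R : R).
Proof. by rewrite /M natrM natrX mulr_gt0 ?exprn_gt0 ?hodge_len_gt0. Qed.

Section Strip.
Variables (b k x0 x1 ya : R).
Hypotheses (k0 : 0 < k) (x10 : x1 < 0) (kpi : k * (x1 - x0) = pi).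
Hypothesis per : forall x y, x < 0 ->
  mnorm2 (x, y - pi *+ 2) * expR (b * (y - pi *+ 2)) = mnorm2 (x, y) * expR (b * y).
Variable z0 : R * R.
Hypotheses (z0x : x0 < z0.1 < x1) (z0y : z0.2 = ya) (z0F : 0 < mnorm2 z0).

Let theta (q : R * R) : R :=
  mnorm2 q * expR (b * q.2) * sin (k * (x1 - q.1)) ^+ M.

Let sin_gt0 x : x0 < x < x1 -> 0 < sin (k * (x1 - x)).
Proof.
move=> /andP[xa xb]; apply: sin_gt0_pi; apply/andP; split.
  by rewrite mulr_gt0 ?subr_gt0.
by rewrite -kpi ltr_pM2l// ltrD2l ltrN2.
Qed.

Let theta_cont q : q.1 < 0 -> {for q, continuous theta}.
Proof.
move=> q0; have q1 : fst @ q --> q.1 by exact: cvg_fst.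
have q2 : snd @ q --> q.2 by exact: cvg_snd.
apply: cvgM; first apply: cvgM; first exact: mnorm2_continuous.
- have c : (fun q : R * R => b * q.2) @ q --> b * q.2 by apply: cvgM => //; exact: cvg_cst.
  exact: (cvg_comp _ _ c (@continuous_expR R _)).
- have c : (fun q : R * R => k * (x1 - q.1)) @ q --> k * (x1 - q.1).
    by apply: cvgM; [exact: cvg_cst|apply: cvgB => //; exact: cvg_cst].
  have s := cvg_comp _ _ c (@continuous_sin R _).
  exact: (cvg_comp _ _ s (@exprn_continuous R M _)).
Qed.

Let theta_per x y : x < 0 -> theta (x, y - pi *+ 2) = theta (x, y).
Proof. by move=> x0'; rewrite /theta /= per. Qed.

(** The maximum over one closed period dominates the neighbouring periods on both sides as well. A
    maximum on a horizontal edge of the rectangle is thus still a maximum over a full neighbourhood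
    in y. *)
Let strip_max : exists2 c : R * R, x0 <= c.1 <= x1 /\ ya <= c.2 <= ya + pi *+ 2 &
  forall q : R * R, x0 <= q.1 <= x1 -> ya - pi *+ 2 <= q.2 <= ya + pi *+ 2 + pi *+ 2 ->
   theta q <= theta c.
Proof.
pose K : set (R * R) := `[x0, x1] `*` `[ya, ya + pi *+ 2].
have pi2 : 0 <= pi *+ 2 :> R by rewrite mulrn_wge0// pi_ge0.
have KP q : K q <-> x0 <= q.1 <= x1 /\ ya <= q.2 <= ya + pi *+ 2.
  by rewrite /K /setX /= !in_itv.
have Kc : compact K by apply: compact_setX; exact: segment_compact.
have K0 : K !=set0.
  by exists z0; apply/KP; case/andP: z0x => /ltW -> /ltW ->; rewrite z0y lexx lerDl.
have tc : {within K, continuous theta}.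
  apply: continuous_in_subspaceT => q /set_mem/KP[/andP[_ qx] _].
  by apply: theta_cont; exact: le_lt_trans qx x10.
have [c /set_mem/KP cK cmax] := compact_EVT_max K0 Kc tc.
exists c => // -[x y] /= xI yI.
have xneg : x < 0 by case/andP: xI => _ /le_lt_trans; apply.
have top y' : ya <= y' <= ya + pi *+ 2 -> theta (x, y') <= theta c.
  by move=> yI'; apply: cmax; apply/mem_set/KP.
have [y1|y1] := leP ya y; last first.
  rewrite -(addrK (pi *+ 2) y) theta_per//; apply: top; lra.
have [y2|y2] := leP y (ya + pi *+ 2); first by apply: top; rewrite y1 y2.
by rewrite -theta_per//; apply: top; lra.
Qed.

Lemma strip_bound : b ^+ 2 <= (M%:R * k) ^+ 2.
Proof.
have [[xc yc] /= [xcI ycI] cmax] := strip_max.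
have pi0 : 0 < pi :> R := pi_gt0 R.
have tc0 : 0 < theta (xc, yc).
  apply: lt_le_trans (cmax z0 _ _); last first.
  - by rewrite z0y; lra.
  - by case/andP: z0x => /ltW -> /ltW ->.
  by rewrite !mulr_gt0 ?expR_gt0// exprn_gt0// sin_gt0.
have xneg : xc < 0 by case/andP: xcI => _ /le_lt_trans; apply.
have hc : half_plane (xc +i* yc)%C by [].
have M_gt0 : (0 < M)%N by rewrite -(ltr0n R).
(* At the maximum [theta] is positive; as M > 0 the sine cannot vanish there. It does vanish on both
   vertical edges, because the strip has width pi / k, so the maximum lies strictly between them. *)
have sc0 : sin (k * (x1 - xc)) != 0.
  by apply: contraTneq tc0 => s0; rewrite /theta /= s0 expr0n gtn_eqF// mulr0 ltxx.
have xcI' : x0 < xc < x1.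
  case/andP: xcI; rewrite !le_eqVlt => /orP[/eqP xE|->] /orP[/eqP xE'|->] //.
  - by move: kpi; rewrite xE xE' subrr mulr0; lra.
  - by move: sc0; rewrite -xE kpi sinpi eqxx.
  - by move: sc0; rewrite xE' subrr mulr0 sin0 eqxx.
have fc0 : 0 < mnorm2 (xc, yc).
  rewrite lt0r (mnorm_ge0 hc) andbT; apply: contraTneq tc0 => f0.
  by rewrite /theta f0 !mul0r ltxx.
have cX := iffRL (punctured_disk_cexp _) hc.
have [i ic] := chart_at cX.
(* The test is made at the image [t] of the maximum, with the branch of the logarithm centred at
   [yc], which sends [t] back to it. Near [t] this branch stays inside the strip and within one
   period of [yc], where [cmax] applies. *)
set t := cexp (xc +i* yc)%C in cX ic.
set p := (Re t, Im t).
have pi2 : 0 < pi / 2 :> R by rewrite divr_gt0.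
have oU := @openC_log_nbhs R n E yc i.
have Up : plane (log_nbhs yc i) p.
  apply: plane_ReIm; split=> //; apply: logdom_cexp.
  by rewrite /= subrr normr0.
have nU : \forall q \near p, plane (log_nbhs yc i) q by exact: (near_open oU Up).
have [gC _] := smooth_log_norm v_flat yc i 2%N.
have WL : plane (log_nbhs yc i) `<=` plane (logdom yc) by move=> q [].
have gE q : plane (log_nbhs yc i) q ->
    re_fun (log_norm v yc i) q = mnorm2 (lograd q, logarg yc q).
  by case: q => q1 q2 Uq; rewrite /re_fun /= log_normE.
have [lp mp] : lograd p = xc /\ logarg yc p = yc.
  have : clog yc t = (xc +i* yc)%C by apply: clog_cexp; rewrite /= subrr normr0.
  by move=> [].
have lc := Ck_continuous (Ck_lograd 0 yc) (WL _ Up).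
have mc := Ck_continuous (Ck_logarg 0 yc) (WL _ Up).
have nl : \forall q \near p, x0 < lograd q < x1.
  move: lc; rewrite /continuous_at lp => lc; case/andP: xcI' => xa xb.
  have na : \forall q \near p, x0 < lograd q by exact: (lc _ (lt_nbhsr xa)).
  have nb : \forall q \near p, lograd q < x1 by exact: (lc _ (lt_nbhsl xb)).
  by apply: filterS2 na nb => q qa qb; rewrite qa qb.
have nm : \forall q \near p, `|logarg yc q - yc| < pi *+ 2.
  move/cvgrPdist_lt : mc => /(_ (pi *+ 2)); rewrite mulrn_wgt0// => /(_ isT).
  by apply: filterS => q; rewrite mp distrC.
have gp0 : 0 < re_fun (log_norm v yc i) p by rewrite gE// lp mp.
have ng : \forall q \near p, 0 < re_fun (log_norm v yc i) q.
  exact: (Ck_continuous gC Up) _ (lt_nbhsr gp0).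
apply: (@no_log_max R yc b k x1 M%:R (hodge_eps E) (re_fun (log_norm v yc i)) p
   (plane (log_nbhs yc i)) oU WL Up gC M0 M_eps ng).
- by apply: filterS nl => q; exact: sin_gt0.
- exact: (log_norm_subharmonic v_flat Up gp0).
have lnT (q : R * R) : 0 < mnorm2 q -> x0 < q.1 < x1 ->
    ln (mnorm2 q) + b * q.2 + M%:R * ln (sin (k * (x1 - q.1))) = ln (theta q) /\ 0 < theta q.
  move=> f0 /sin_gt0 s0; have t0 : 0 < theta q by rewrite !mulr_gt0 ?expR_gt0 ?exprn_gt0.
  split=> //; rewrite /theta !lnM ?posrE ?mulr_gt0 ?expR_gt0 ?exprn_gt0//.
  by rewrite expRK lnXn// mulr_natl.
near=> q.
have Uq : plane (log_nbhs yc i) q by near: q.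
have lq : x0 < lograd q < x1 by near: q.
have gq : 0 < re_fun (log_norm v yc i) q by near: q.
have mq : `|logarg yc q - yc| < pi *+ 2 by near: q.
move: gq; rewrite !gE// => gq.
have [Eq tq] := lnT (lograd q, logarg yc q) gq lq.
have [Ep tp] : _ := lnT (xc, yc) fc0 xcI'.
rewrite /= in Eq Ep; rewrite Eq lp mp Ep ler_ln ?posrE//.
apply: cmax => /=; first by case/andP: lq => /ltW -> /ltW ->.
by move: mq; rewrite ltr_norml; lra.
Unshelve. all: by end_near. Qed.

End Strip.

End GlobalArgument.

Theorem mainTheorem1 (R : realType) (n : int)
    (E : pvhs (@punctured_disk R) n) (lambda : R[i]) :
  monodromy_eigenvalue (conn E) lambda -> `|lambda| = 1.
Proof.
move=> [v [v_flat [z0 hz0 vz0] mono]].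
pose L := complex.Re lambda ^+ 2 + complex.Im lambda ^+ 2.
suff L1 : L = 1 by rewrite normc_def -/L L1 sqrtr1.
apply/eqP/negPn/negP => L1.
have F0 := mnorm_gt0 hz0 vz0.
have per z (hz : half_plane z) : mnorm v (z - two_pi_i R) = L * mnorm v z.
  exact: mnorm_monodromy.
have pi0 : 0 < pi :> R := pi_gt0 R.
have L0 : 0 < L.
  rewrite lt0r addr_ge0 ?sqr_ge0// andbT; apply: contraTneq F0 => L0.
  (* [z0] is the translate by - 2 pi i of this point, so L = 0 would make the norm vanish at
     [z0]. *)
  have h : half_plane (z0 + two_pi_i R).
    by case: (z0) hz0 => x y; rewrite /half_plane /= addr0.
  by rewrite -(addrK (two_pi_i R) z0) per// L0 mul0r ltxx.
have lnL : ln L != 0 by rewrite ln_eq0.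
pose b := ln L / (pi *+ 2).
have pi2 : pi *+ 2 != 0 :> R by rewrite mulrn_eq0 /= lt0r_neq0.
have b0 : b != 0 by rewrite mulf_neq0 ?invr_eq0.
pose M : R := (4 * hodge_len E ^ 2)%:R.
have M0 : 0 < M by rewrite /M natrM natrX mulr_gt0 ?exprn_gt0 ?hodge_len_gt0.
pose X := complex.Re z0.
have X0 : X < 0 := hz0.
(* The first bound gives M k <= |b| / 2 < |b|. The second makes the width pi / k at least |X|, so
   the strip ending at X / 2 < 0 contains X, the real part of a point where v does not vanish. *)
pose k := Num.min (`|b| / (2 * M)) (pi / - X).
have k0 : 0 < k by rewrite lt_min !divr_gt0 ?normr_gt0 ?mulr_gt0// oppr_gt0.
have kb : M * k <= `|b| / 2.
  have : k <= `|b| / (2 * M) by rewrite ge_min lexx.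
  move=> /(ler_wpM2l (ltW M0)); rewrite (_ : M * (`|b| / (2 * M)) = `|b| / 2)//.
  by field; rewrite lt0r_neq0.
have kX : - X <= pi / k.
  have : k <= pi / - X by rewrite ge_min lexx orbT.
  by rewrite ler_pdivlMr ?oppr_gt0// ler_pdivlMr// mulrC.
have perb x y : x < 0 ->
    mnorm2 v (x, y - pi *+ 2) * expR (b * (y - pi *+ 2)) = mnorm2 v (x, y) * expR (b * y).
  move=> x0; have := per (x +i* y)%C x0.
  rewrite (_ : (x +i* y)%C - two_pi_i R = (x +i* (y - pi *+ 2))%C); last first.
    by apply/eqP; rewrite eq_complex /= subr0 !eqxx.
  rewrite -/(mnorm2 v (x, y - pi *+ 2)) -/(mnorm2 v (x, y)) => ->.
  rewrite mulrBr expRD expRN divfK// lnK ?posrE//.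
  by rewrite [L * _]mulrC -mulrA [L * _]mulrC mulfVK ?lt0r_neq0.
have z0E : mnorm2 v (X, complex.Im z0) = mnorm v z0.
  by rewrite /mnorm2 /= -complexE.
have := @strip_bound R n E v v_flat b k (X / 2 - pi / k) (X / 2) (complex.Im z0) k0 _ _ perb
  (X, complex.Im z0) _ erefl _.
rewrite z0E F0 /= => H.
have : b ^+ 2 <= (M * k) ^+ 2.
  apply: H => //.
  - by rewrite ltr_pdivrMr// mul0r.
  - by rewrite opprB addrC subrK mulrC divfK// lt0r_neq0.
  - by apply/andP; split; lra.
rewrite -[b ^+ 2]real_normK ?num_real// leNgt => /negP; apply.
have Mk0 : 0 < M * k by rewrite mulr_gt0.
have nb0 : 0 < `|b| by rewrite normr_gt0.
by rewrite ltr_pXn2r ?nnegrE ?ltW//; lra.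
Qed.
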